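(* Let $\mathcal{S}$ be a finite connected poset of Class B, and let $\mathcal{A}$ be a finite connected poset. Then monotonicity equivalence holds for $(\mathcal{A},\mathcal{S})$ if and only if $\mathcal{A}$ is an acyclic poset.
   Context: All posets are finite. For a poset $\mathcal{S}$ with ground set $S$: $y$ covers $x$ if $x<y$ and no $z\in S$ satisfies $x<z<y$. The cover graph of $\mathcal{S}$ is the undirected graph on $S$ whose edges are the pairs $\{x,y\}$ such that one of $x,y$ covers the other. $\mathcal{S}$ is connected if its cover graph is connected; it has a cycle if its cover graph contains a cycle (in the usual graph-theoretic sense), and it is acyclic otherwise. An induced subposet of $\mathcal{S}$ is a subset of $S$ with the restricted order; ''$\mathcal{S}$ has an induced $\mathcal{Q}$'' means some induced subposet of $\mathcal{S}$ is isomorphic to $\mathcal{Q}$. The bowtie is the poset on four elements $x_0,x_1,y_0,y_1$ whose only strict relations are $x_i<y_j$ for all $i,j\in\{0,1\}$. A connected poset $\mathcal{S}$ is in Class B if $\mathcal{S}$ has either a cycle or an induced bowtie. An up-set of $\mathcal{S}$ is a set $U\subseteq S$ such that $x\in U$ and $x\le y$ imply $y\in U$. For probability measures $P_1,P_2$ on $S$, write $P_1\preceq P_2$ if $P_1(U)\le P_2(U)$ for every up-set $U$ of $\mathcal{S}$. Let $\mathcal{A}$ (ground set $A$) and $\mathcal{S}$ (ground set $S$) be finite posets and let $(P_\alpha:\alpha\in A)$ be a system of probability measures on $S$. The system is stochastically monotone if $P_\alpha\preceq P_\beta$ whenever $\alpha\le\beta$ in $\mathcal{A}$. It is realizably monotone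 if there exist $S$-valued random variables $(\mathbf{X}_\alpha:\alpha\in A)$ on a common probability space such that $\mathbf{X}_\alpha\le\mathbf{X}_\beta$ in $\mathcal{S}$ whenever $\alpha\le\beta$ in $\mathcal{A}$, and $\mathbf{X}_\alpha$ has distribution $P_\alpha$ for every $\alpha\in A$. Monotonicity equivalence holds for $(\mathcal{A},\mathcal{S})$ if every stochastically monotone system $(P_\alpha:\alpha\in A)$ of probability measures on $S$ is realizably monotone. *)

(* Defs.v *)
From HB Require Import structures.
From mathcomp Require Import all_boot all_order all_algebra.
From mathcomp Require Import all_classical all_reals all_analysis.

Set Implicit Arguments.
Unset Strict Implicit.
Unset Printing Implicit Defensive.

Import Order.TTheory.

Local Open Scope classical_set_scope.
Local Open Scope order_scope.

Definition covers d (S : finPOrderType d) : rel S :=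
  fun y x => (x < y) && [forall z, ~~ (x < z < y)].

Definition cover_graph d (S : finPOrderType d) : rel S :=
  fun x y => covers x y || covers y x.

Definition connected_poset d (S : finPOrderType d) : Prop :=
  forall x y : S, connect (@cover_graph d S) x y.

(* [ucycle] also accepts the sequence [:: x; y] for a single edge {x, y}; a
   cycle of a simple graph has at least three vertices. *)
Definition has_cycle d (S : finPOrderType d) : Prop :=
  exists c : seq S, ucycle (@cover_graph d S) c /\ (2 < size c)%N.

Definition acyclic_poset d (S : finPOrderType d) : Prop := ~ has_cycle S.

Definition has_induced dQ dS (Q : finPOrderType dQ) (S : finPOrderType dS) :
    Prop :=
  exists (U : {set S}) (f : Q -> {x : S | x \in U}),
    bijective f /\ forall p q : Q, (p <= q) = (val (f p) <= val (f q)).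

(* x_i is encoded as (false, i) and y_j as (true, j). *)
Definition bowtie : Type := (bool * bool)%type.

HB.instance Definition _ := Finite.on bowtie.

Definition bowtie_le : rel bowtie := fun p q => (p == q) || (~~ p.1 && q.1).

Lemma bowtie_le_refl : reflexive bowtie_le.
Proof. by move=> p; rewrite /bowtie_le eqxx. Qed.

Lemma bowtie_le_anti : antisymmetric bowtie_le.
Proof. by move=> [[] []] [[] []]. Qed.

Lemma bowtie_le_trans : transitive bowtie_le.
Proof. by move=> [[] []] [[] []] [[] []]. Qed.

Fact bowtie_display : Order.disp_t. Proof. exact: Order.Disp tt tt. Qed.

HB.instance Definition _ := Order.Le_isPOrder.Build bowtie_display bowtie
  bowtie_le_refl bowtie_le_anti bowtie_le_trans.

Definition class_B d (S : finPOrderType d) : Prop :=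
  connected_poset S /\ (has_cycle S \/ has_induced bowtie S).

Definition up_set d (S : finPOrderType d) (U : set S) : Prop :=
  forall x y : S, U x -> x <= y -> U y.

(* The finite type S with the sigma-algebra of all its subsets. Measurable
   types are pointed, hence the parameter x0, which plays no other role. *)
Definition discrete (S : finType) (x0 : S) : Type := S.

Section discrete_instance.
Variables (S : finType) (x0 : S).

HB.instance Definition _ := Choice.on (discrete x0).
HB.instance Definition _ := isPointed.Build (discrete x0) x0.
HB.instance Definition _ := @isMeasurable.Build default_measure_display
  (discrete x0) discrete_measurable discrete_measurable0
  discrete_measurableC discrete_measurableU.

End discrete_instance.

Section systems.
Variables (R : realType) (dA dS : Order.disp_t).
Variables (A : finPOrderType dA) (S : finPOrderType dS) (x0 : S).

Definition stochastic_le (P1 P2 : probability (discrete x0) R) : Prop :=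
  forall U : set S, up_set U -> (P1 U <= P2 U)%E.

Definition stochastically_monotone (P : A -> probability (discrete x0) R) :
    Prop :=
  forall a b : A, a <= b -> stochastic_le (P a) (P b).

Definition realizably_monotone (P : A -> probability (discrete x0) R) : Prop :=
  exists (d : measure_display) (T : measurableType d) (mu : probability T R)
         (X : A -> {RV mu >-> discrete x0}),
    (forall a b : A, a <= b -> forall t : T, (X a t : S) <= (X b t : S)) /\
    (forall (a : A) (B : set S), distribution mu (X a) B = P a B).

End systems.

(* If S is empty the equivalence holds trivially, both for empty and for
   nonempty A, so quantifying over a point x0 of S loses nothing. *)
Definition monotonicity_equivalence (R : realType) (dA dS : Order.disp_t)
    (A : finPOrderType dA) (S : finPOrderType dS) : Prop :=
  forall (x0 : S) (P : A -> probability (discrete x0) R),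
    stochastically_monotone P -> realizably_monotone P.

(* Main.v *)
(* If A is acyclic and connected, its cover graph is a tree. Strassen's theorem
   (proved by the Halmos-Vaughan argument for Hall's condition with real weights)
   couples the two laws on each edge, and the couplings are glued along the tree
   as a Markov chain.

   If A has a cycle, then either A contains a diamond a < b, c < d, or all its
   intervals are chains and, {u, v} being an edge of the cycle, A maps
   monotonically to the bowtie so that {u, v} is the only edge over one of the
   four edges of the bowtie. Likewise S contains a diamond, or a closed zigzag
   in which some points have no other comparabilities. In each of the four cases
   there are laws, uniform on short lists of points of S and indexed by the
   diamond or by the bowtie, that are stochastically monotone. When two
   comparable laws give the same mass to an up-set, the corresponding events
   coincide in every realization. Following such an event around the cycle of A
   leads to a disjoint event, a contradiction. *)

Require Import Defs.
From HB Require Import structures.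
From mathcomp Require Import all_boot all_order all_algebra.
From mathcomp Require Import all_classical all_reals all_analysis.
From mathcomp Require Import lra zify.

Set Implicit Arguments.
Unset Strict Implicit.
Unset Printing Implicit Defensive.

Import Order.TTheory GRing.Theory Num.Theory.
Local Open Scope ring_scope.

(** * Strassen's theorem on finite posets *)

Section transport.
Variables (R : realFieldType) (I J : finType) (r : I -> J -> bool).

Definition neighbours (X : {set I}) : {set J} :=
  [set j | [exists i in X, r i j]].

Lemma neighbours_sub (X Y : {set I}) :
  X \subset Y -> neighbours X \subset neighbours Y.
Proof.
move=> XY; apply/fintype.subsetP => j; rewrite !inE => /existsP[i /andP[iX rij]].
by apply/existsP; exists i; rewrite (fintype.subsetP XY).
Qed.

Lemma neighboursU (X Y : {set I}) :
  neighbours (X :|: Y) = neighbours X :|: neighbours Y.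
Proof.
apply/setP => j; rewrite !inE; apply/existsP/orP.
  by case=> i; rewrite inE => /andP[/orP[iX|iY] rij]; [left|right];
    apply/existsP; exists i; apply/andP.
by case=> /existsP[i /andP[iX rij]]; exists i; rewrite inE iX ?orbT.
Qed.

Definition hall (a : I -> R) (b : J -> R) : Prop :=
  forall X : {set I}, \sum_(i in X) a i <= \sum_(j in neighbours X) b j.

(** Rows are exact while columns are only bounded, since Hall's condition lets [b] have the larger
    total; [strassen] recovers equality in the columns from equal totals. *)
Definition transport (a : I -> R) (b : J -> R) (q : I -> J -> R) : Prop :=
  [/\ forall i j, 0 <= q i j, forall i j, q i j != 0 -> r i j,
      forall i, \sum_j q i j = a i & forall j, \sum_i q i j <= b j].

(** The measure on which the induction in [hall_transport] runs. *)
Let supports (a : I -> R) (b : J -> R) : nat :=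
  (#|[set i | a i != 0%R]| + #|[set j | b j != 0%R]|)%N.

Lemma transport_add a1 b1 q1 a2 b2 q2 :
    transport a1 b1 q1 -> transport a2 b2 q2 ->
  transport (fun i => a1 i + a2 i) (fun j => b1 j + b2 j)
    (fun i j => q1 i j + q2 i j).
Proof.
move=> [p1 s1 r1 c1] [p2 s2 r2 c2]; split=> [i j|i j|i|j].
- by rewrite addr_ge0.
- have [->|/s1 //] := eqVneq (q1 i j) 0.
  by rewrite add0r; exact: s2.
- by rewrite big_split r1 r2.
- by rewrite big_split lerD.
Qed.

Lemma transport_ext a1 b1 a2 b2 q : a1 =1 a2 -> b1 =1 b2 ->
  transport a1 b1 q -> transport a2 b2 q.
Proof.
by move=> ea eb [p s e c]; split=> // [i|j]; rewrite -?ea -?eb.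
Qed.

Lemma transport_delta (e : R) i0 j0 : 0 <= e -> r i0 j0 ->
  transport (fun i => if i == i0 then e else 0)
    (fun j => if j == j0 then e else 0)
    (fun i j => if (i == i0) && (j == j0) then e else 0).
Proof.
move=> e0 rij; split=> [i j|i j|i|j].
- by case: ifP.
- by case: ifP => [/andP[/eqP -> /eqP ->] //|]; rewrite eqxx.
- by case: eqP => _ /=; [rewrite -big_mkcond big_pred1_eq|rewrite big1].
- under eq_bigr do rewrite andbC.
  by case: eqP => _ /=; [rewrite -big_mkcond big_pred1_eq|rewrite big1].
Qed.

Lemma sum_sub_delta (K : finType) (f : K -> R) k0 (e : R) (X : {set K}) :
  \sum_(k in X) (f k - (if k == k0 then e else 0)) =
  \sum_(k in X) f k - (if k0 \in X then e else 0).
Proof.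
rewrite sumrB; congr (_ - _); rewrite -big_mkcondr /=.
case: ifP => kX.
  rewrite (big_pred1 k0) // => k /=.
  by case: eqP => [->|]; rewrite ?kX ?andbF.
by rewrite big1 // => k /andP[kX' /eqP kk]; rewrite kk kX in kX'.
Qed.

Lemma supports_lt (a a' : I -> R) (b b' : J -> R) :
    (forall i, a i = 0 -> a' i = 0) -> (forall j, b j = 0 -> b' j = 0) ->
    (exists2 i, a i != 0 & a' i = 0) \/ (exists2 j, b j != 0 & b' j = 0) ->
  (supports a' b' < supports a b)%N.
Proof.
move=> a0 b0 strict.
have sa : [set i | a' i != 0] \subset [set i | a i != 0].
  by apply/fintype.subsetP => i; rewrite !inE; apply: contra_neq; exact: a0.
have sb : [set j | b' j != 0] \subset [set j | b j != 0].
  by apply/fintype.subsetP => j; rewrite !inE; apply: contra_neq; exact: b0.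
case: strict => -[k k0 k0']; rewrite /supports.
  rewrite -addSn leq_add ?subset_leq_card //; apply/proper_card/properP.
  by split=> //; exists k; rewrite inE // k0' eqxx.
rewrite -addnS leq_add ?subset_leq_card //; apply/proper_card/properP.
by split=> //; exists k; rewrite inE // k0' eqxx.
Qed.

Let restrict (K : finType) (X : {set K}) (f : K -> R) k :=
  if k \in X then f k else 0.

Lemma sum_restrict (K : finType) (X Y : {set K}) (f : K -> R) :
  \sum_(k in Y) restrict X f k = \sum_(k in Y :&: X) f k.
Proof.
rewrite -big_mkcondr; apply: eq_bigl => k; by rewrite inE.
Qed.

Lemma sum_setID_eq (K : finType) (X Y : {set K}) (f : K -> R) :
  \sum_(k in Y :|: X) f k = \sum_(k in Y :&: ~: X) f k + \sum_(k in X) f k.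
Proof.
rewrite (big_setID X) /= (finset.setUC Y X) finset.setUK addrC; congr (_ + _).
by apply: eq_bigl => k; rewrite !inE; case: (k \in X); rewrite ?andbF ?andbT.
Qed.

(** Only [Y :&: X] carries mass, and its neighbours already lie in [neighbours X]. *)
Lemma hall_inside a b (X : {set I}) : (forall i, 0 <= a i) ->
    (forall j, 0 <= b j) -> hall a b ->
  hall (restrict X a) (restrict (neighbours X) b).
Proof.
move=> a0 b0 H Y; rewrite !sum_restrict; apply: le_trans (H _) _.
have sub : neighbours (Y :&: X) \subset neighbours Y :&: neighbours X.
  by rewrite finset.subsetI !neighbours_sub // ?finset.subsetIl ?finset.subsetIr.
rewrite [leRHS](big_setID (neighbours (Y :&: X))) /= (finset.setIidPr sub).
by rewrite lerDl sumr_ge0.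
Qed.

(* Subtract the equality for X from Hall's inequality for X :|: Y. *)
Lemma hall_outside a b (X : {set I}) :
    hall a b -> \sum_(i in X) a i = \sum_(j in neighbours X) b j ->
  hall (restrict (~: X) a) (restrict (~: neighbours X) b).
Proof.
move=> H tX Y; rewrite !sum_restrict.
by have := H (Y :|: X); rewrite neighboursU !sum_setID_eq tX lerD2r.
Qed.

(** Some mass is shipped along one admissible pair of the supports. Either this exhausts an end of
    the pair, or it makes Hall's inequality tight for some [X] and the problem splits in two; the
    supports shrink in both cases. *)
Lemma hall_transport a b : (forall i, 0 <= a i) -> (forall j, 0 <= b j) ->
  hall a b -> exists q, transport a b q.
Proof.
have [n] := ubnP (supports a b); elim: n => // n IHn in a b *.
rewrite ltnS => size_ab a_ge0 b_ge0 H.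
have [i0 ai0|a0] := pickP (fun i => a i != 0); last first.
  exists (fun _ _ => 0); split=> // [i j|i|j]; first by rewrite eqxx.
    by rewrite big1_eq; apply/esym/eqP; have /negbFE := a0 i.
  by rewrite big1_eq.
have ai0_gt0 : 0 < a i0 by rewrite lt_neqAle eq_sym ai0 a_ge0.
have [j0 /andP[rij bj0]] : exists j0, r i0 j0 && (b j0 != 0).
  apply/existsP; apply: contraLR ai0_gt0 => /existsPn no; rewrite -leNgt.
  have := H [set i0]; rewrite big_set1 => /le_trans; apply.
  rewrite big1 // => j; rewrite inE => /existsP[i]; rewrite inE.
  by case/andP=> /eqP -> rij; have := no j; rewrite rij => /negbNE/eqP.
have bj0_gt0 : 0 < b j0 by rewrite lt_neqAle eq_sym bj0 b_ge0.
pose slack (X : {set I}) := \sum_(j in neighbours X) b j - \sum_(i in X) a i.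
(* The sets for which shipping from [i0] to [j0] lowers only the right side of Hall's inequality: if
   [i0] is in [X], then [j0] is in [neighbours X] and both sides drop equally. *)
pose crossing (X : {set I}) := (i0 \notin X) && (j0 \in neighbours X).
pose a' e i := a i - if i == i0 then e else 0.
pose b' e j := b j - if j == j0 then e else 0.
have hall' e : (forall X, crossing X -> e <= slack X) -> hall (a' e) (b' e).
  move=> He X; rewrite !sum_sub_delta.
  have [iX|iX] := boolP (i0 \in X).
    have -> : j0 \in neighbours X.
      by rewrite inE; apply/existsP; exists i0; rewrite iX.
    by rewrite lerD2r.
  have [jX|jX] := boolP (j0 \in neighbours X); last by rewrite !subr0.
  by have := He X; rewrite /crossing /slack iX jX => /(_ isT); lra.
have finish e q : 0 <= e -> transport (a' e) (b' e) q -> exists q, transport a b q.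
  move=> e0 tq; have td := transport_delta e0 rij.
  eexists; apply: transport_ext (transport_add tq td) => k; rewrite /a' /b';
    exact: subrK.
have a'_ge0 e : e <= a i0 -> forall i, 0 <= a' e i.
  by move=> ea i; rewrite /a'; case: eqP => [->|_]; rewrite ?subr0 // subr_ge0.
have b'_ge0 e : e <= b j0 -> forall j, 0 <= b' e j.
  by move=> eb j; rewrite /b'; case: eqP => [->|_]; rewrite ?subr0 // subr_ge0.
have a'0 e : e <= a i0 -> 0 <= e -> forall i, a i = 0 -> a' e i = 0.
  move=> ea e0 i ai; apply/eqP; rewrite eq_le a'_ge0 // andbT.
  by rewrite /a' ai sub0r oppr_le0; case: ifP.
have b'0 e : e <= b j0 -> 0 <= e -> forall j, b j = 0 -> b' e j = 0.
  move=> ea e0 j bj; apply/eqP; rewrite eq_le b'_ge0 // andbT.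
  by rewrite /b' bj sub0r oppr_le0; case: ifP.
(* The largest possible shipment, which exhausts [i0] or [j0]; only a crossing set with slack below
   [m] forbids it. *)
pose m := Num.min (a i0) (b j0).
have m_ge0 : 0 <= m by rewrite le_min !ltW.
have ma : m <= a i0 by rewrite ge_min lexx.
have mb : m <= b j0 by rewrite ge_min lexx orbT.
have [X0 /andP[cX0 sX0]|no] :=
  pickP (fun X => crossing X && (slack X < m)); last first.
  have [q tq] : exists q, transport (a' m) (b' m) q.
    apply: IHn; [|exact: a'_ge0|exact: b'_ge0|apply: hall'] => //.
      apply: leq_trans size_ab; apply: supports_lt; [exact: a'0|exact: b'0|].
      rewrite /m; case: (leP (a i0) (b j0)) => _.
        by left; exists i0 => //; rewrite /a' eqxx subrr.
      by right; exists j0 => //; rewrite /b' eqxx subrr.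
    by move=> X cX; have := no X; rewrite /= cX leNgt /= => ->.
  exact: finish tq.
(* If [m] is too much, the least slack of a crossing set is shipped, and the minimizing [X] becomes
   tight. *)
have [X cX minX] := @arg_minP _ _ _ X0 crossing slack cX0.
pose e := slack X.
have e_ge0 : 0 <= e by rewrite subr_ge0.
have em : e < m by apply: le_lt_trans (minX _ cX0) sX0.
have ea := le_trans (ltW em) ma; have eb := le_trans (ltW em) mb.
have H' := hall' e minX.
have tight : \sum_(i in X) a' e i = \sum_(j in neighbours X) b' e j.
  rewrite !sum_sub_delta; case/andP: cX => /negbTE -> ->.
  by rewrite subr0 /e /slack opprB addrC subrK.
(* The part inside [X] loses [i0] from its support, the part outside loses [j0], so induction
   applies to both. *)
have [iX jX] := andP cX.
have [q1 t1] : exists q,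
    transport (restrict X (a' e)) (restrict (neighbours X) (b' e)) q.
  apply: IHn.
  - apply: leq_trans size_ab; apply: supports_lt => [i ai|j bj|].
    + by rewrite /restrict a'0 // if_same.
    + by rewrite /restrict b'0 // if_same.
    + by left; exists i0; rewrite // /restrict (negbTE iX).
  - by move=> i; rewrite /restrict; case: ifP => // _; exact: a'_ge0.
  - by move=> j; rewrite /restrict; case: ifP => // _; exact: b'_ge0.
  - by apply: hall_inside H' => *; [exact: a'_ge0|exact: b'_ge0].
have [q2 t2] : exists q,
    transport (restrict (~: X) (a' e)) (restrict (~: neighbours X) (b' e)) q.
  apply: IHn.
  - apply: leq_trans size_ab; apply: supports_lt => [i ai|j bj|].
    + by rewrite /restrict a'0 // if_same.
    + by rewrite /restrict b'0 // if_same.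
    + by right; exists j0; rewrite // /restrict finset.in_setC jX.
  - by move=> i; rewrite /restrict; case: ifP => // _; exact: a'_ge0.
  - by move=> j; rewrite /restrict; case: ifP => // _; exact: b'_ge0.
  - exact: hall_outside.
apply: (finish e) => //; apply: transport_ext (transport_add t1 t2) => k;
  by rewrite /restrict finset.in_setC; case: ifP => _; rewrite ?addr0 ?add0r.
Qed.

End transport.

Section cover_graph.
Variables (d : Order.disp_t) (A : finPOrderType d).

Lemma cover_graph_sym : symmetric (@cover_graph d A).
Proof. by move=> x y; rewrite /cover_graph orbC. Qed.

(** Induction on the size of the interval: a pair that is not a cover splits at an interior point
    into two smaller intervals. *)
Lemma le_ind_covers (Q : rel A) : reflexive Q -> transitive Q ->
  (forall x y, covers y x -> Q x y) -> forall x y, (x <= y)%O -> Q x y.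
Proof.
move=> Qr Qt Qc x y.
have [n] := ubnP #|[set z | (x <= z <= y)%O]|; elim: n x y => // n IHn x y.
rewrite ltnS => xyn; rewrite le_eqVlt => /orP[/eqP -> //|xy].
have [xyc|] := boolP (covers y x); first exact: Qc.
rewrite /covers xy /= => /forallPn[z]; rewrite negbK => /andP[xz zy].
apply: (@Qt z); apply: IHn (ltW _) => //; apply: leq_trans xyn;
  apply/proper_card/properP; split.
- by apply/fintype.subsetP => u; rewrite !inE => /andP[-> /le_trans->] //; exact: ltW.
- by exists y; rewrite inE ?lexx ?(ltW xy) // (lt_geF zy) andbF.
- by apply/fintype.subsetP => u; rewrite !inE => /andP[/(le_trans (ltW xz)) -> ->].
- by exists x; rewrite inE ?lexx ?(ltW xy) // (lt_geF xz).
Qed.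

End cover_graph.

Section strassen.
Variables (R : realFieldType) (d : Order.disp_t) (S : finPOrderType d).

Definition upper_set (U : {set S}) : Prop :=
  forall x y, x \in U -> (x <= y)%O -> y \in U.

Definition dominated (p q : S -> R) : Prop :=
  forall U : {set S}, upper_set U -> \sum_(s in U) p s <= \sum_(s in U) q s.

(** For the relation [<=], the neighbours of [X] form the up-set generated by [X], so domination
    yields Hall's condition. *)
Lemma strassen (p q : S -> R) : (forall s, 0 <= p s) -> (forall s, 0 <= q s) ->
    \sum_s p s = \sum_s q s -> dominated p q ->
  exists c : S -> S -> R,
    [/\ forall x y, 0 <= c x y, forall x y, c x y != 0 -> (x <= y)%O,
        forall x, \sum_y c x y = p x & forall y, \sum_x c x y = q y].
Proof.
move=> p_ge0 q_ge0 pq dom.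
have [|c [c_ge0 c_le c_row c_col]] :=
    hall_transport (r := fun x y : S => (x <= y)%O) p_ge0 q_ge0.
  move=> X; apply: le_trans (dom _ _).
    rewrite [leRHS](big_setID X) /= (finset.setIidPr _).
      by rewrite lerDl sumr_ge0.
    apply/fintype.subsetP => x xX; rewrite inE; apply/existsP; exists x.
    by rewrite xX lexx.
  move=> x y; rewrite !inE => /existsP[z /andP[zX zx]] xy.
  by apply/existsP; exists z; rewrite zX (le_trans zx).
(* The column gaps are nonnegative and add up to the difference of the total masses, which is
   zero. *)
exists c; split=> // y; apply/eqP; rewrite eq_sym -subr_eq0; apply/eqP.
have gap_ge0 z : true -> 0 <= q z - \sum_x c x z by rewrite subr_ge0.
apply: (psumr_eq0P gap_ge0) => //.
by rewrite sumrB exchange_big /= (eq_bigr _ (fun x _ => c_row x)) pq subrr.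
Qed.

End strassen.

(** * Gluing couplings along a tree *)

Section gluing.
Variables (R : realFieldType) (dA dS : Order.disp_t).
Variables (A : finPOrderType dA) (S : finPOrderType dS) (x0 : S).
Variable p : A -> S -> R.
Hypothesis p_ge0 : forall a s, 0 <= p a s.
Hypothesis p_sum1 : forall a, \sum_s p a s = 1.
Hypothesis p_mono : forall a b, (a <= b)%O -> dominated (p a) (p b).
Hypothesis A_acyclic : acyclic_poset A.
Hypothesis A_connected : connected_poset A.

(** Monotonicity is asked along covers only; once [B] is all of [A], [le_ind_covers] extends it to
    the whole order. *)
Definition realized_on (B : {set A}) : Prop :=
  exists (T : finType) (w : T -> R) (X : A -> T -> S),
    [/\ forall t, 0 <= w t,
        \sum_t w t = 1,
        forall a b t, a \in B -> b \in B -> covers b a ->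
          0 < w t -> (X a t <= X b t)%O &
        forall a s, a \in B -> \sum_(t | X a t == s) w t = p a s].

Let within (B : {set A}) : rel A :=
  [rel x y | [&& x \in B, y \in B & cover_graph x y]].

Definition connected_set (B : {set A}) : Prop :=
  forall x y, x \in B -> y \in B -> connect (within B) x y.

(** Two distinct neighbours of [c] in [B] are joined by a simple path in [B], which [c] would close
    to a cycle. *)
Lemma unique_attachment (B : {set A}) c b b' : connected_set B ->
    c \notin B -> b \in B -> b' \in B -> cover_graph c b -> cover_graph c b' ->
  b = b'.
Proof.
move=> B_conn cB bB b'B cb cb'; apply/eqP/negPn/negP => bb'.
have /connectP[q0 bq0 lq0] := B_conn _ _ bB b'B.
move: bb' cb' b'B; rewrite lq0; case: (shortenP bq0) => q bq uq _ bb' cb' _.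
apply: A_acyclic; exists [:: c, b & q]; split; last first.
  by case: q bb' {bq uq cb'} => //=; rewrite eqxx.
have qB : all (mem B) (b :: q).
  elim: q b bB bq {uq bb' cb cb' lq0 bq0} => [|z q IHq] b bB /=; first by rewrite bB.
  by by case/andP=> /and3P[_ zB _] /(IHq _ zB); rewrite bB.
apply/andP; split; last first.
  by rewrite cons_uniq uq andbT; apply: contra cB => /(allP qB).
rewrite /= cb rcons_path cover_graph_sym cb' andbT.
by apply: sub_path bq => x y /and3P[].
Qed.

(** The conditional law of the second coordinate of a Strassen coupling given the first, for an edge
    oriented either way. *)
Lemma transition_kernel a b : cover_graph a b ->
  exists k : S -> S -> R,
    [/\ forall x y, 0 <= k x y,
        forall x y, k x y != 0 ->
          (covers b a -> (x <= y)%O) /\ (covers a b -> (y <= x)%O),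
        forall x, p a x != 0 -> \sum_y k x y = 1 &
        forall y, \sum_x p a x * k x y = p b y].
Proof.
have kernel (c : S -> S -> R) (Q : S -> S -> Prop) :
    (forall x y, 0 <= c x y) -> (forall x y, c x y != 0 -> Q x y) ->
    (forall x, \sum_y c x y = p a x) -> (forall y, \sum_x c x y = p b y) ->
  exists k : S -> S -> R,
    [/\ forall x y, 0 <= k x y, forall x y, k x y != 0 -> Q x y,
        forall x, p a x != 0 -> \sum_y k x y = 1 &
        forall y, \sum_x p a x * k x y = p b y].
  (* Where [p a x] is zero the quotient is zero by convention, hence row sums equal to 1 only where
     [p a x != 0]. *)
  move=> c0 cQ c_row c_col; exists (fun x y => c x y / p a x).
  split=> [x y|x y|x px|y].
  - by rewrite divr_ge0.
  - by rewrite mulf_eq0 negb_or => /andP[/cQ].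
  - by rewrite -mulr_suml c_row divff.
  rewrite -c_col; apply: eq_bigr => x _.
  have [px|px] := eqVneq (p a x) 0; last by rewrite mulrC divfK.
  rewrite px mul0r; apply/esym.
  apply: (psumr_eq0P (P := predT) (fun z _ => c0 x z)) => //.
  by rewrite c_row.
have noanti x y : covers x y -> covers y x -> False.
  by case/andP=> xy _ /andP[/(lt_trans xy)]; rewrite ltxx.
have sum_eq u v : \sum_s p u s = \sum_s p v s by rewrite !p_sum1.
case/orP => ab; have [/ltW le_ab _] := andP ab.
  have [c [c0 cle c_row c_col]] :=
    strassen (p_ge0 b) (p_ge0 a) (sum_eq b a) (p_mono le_ab).
  apply: (kernel (fun x y => c y x)) => // x y /cle yx; split=> //.
  by move=> /noanti; case/(_ ab).
have [c [c0 cle c_row c_col]] :=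
  strassen (p_ge0 a) (p_ge0 b) (sum_eq a b) (p_mono le_ab).
apply: (kernel c) => // x y /cle xy; split=> //.
by move=> /noanti; case/(_ ab).
Qed.

(** One Markov step: the value at [c] is drawn from the kernel given the value at [b], on the
    product [T * S]. As [b] is the only neighbour of [c] in [B], no other cover has to be
    respected. *)
Lemma realized_on_extend (B : {set A}) b c : b \in B -> c \notin B ->
    cover_graph b c -> (forall b', b' \in B -> cover_graph c b' -> b' = b) ->
  realized_on B -> realized_on (c |: B).
Proof.
move=> bB cB bc b_uniq [T [w [X [w_ge0 w_sum1 Xmono Xp]]]].
have [k [k_ge0 k_le k_row k_col]] := transition_kernel bc.
(* If [p b] vanishes at [X b t], then so does [w t]; the rows of [k] that do not sum to 1 are thus
   never reached with positive weight. *)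
have wk t : w t * \sum_y k (X b t) y = w t.
  have [-> |wt] := eqVneq (w t) 0; first by rewrite mul0r.
  rewrite k_row ?mulr1 // -Xp //; apply: contra_neq wt => h.
  exact: (psumr_eq0P (P := fun u => X b u == X b t) (fun u _ => w_ge0 u) h).
exists (T * S)%type, (fun ts => w ts.1 * k (X b ts.1) ts.2),
  (fun a ts => if a == c then ts.2 else X a ts.1); split=> [t||a a' [t s]|a s].
- by rewrite mulr_ge0.
- rewrite -(pair_bigA _ (fun t s => w t * k (X b t) s)) /= -w_sum1.
  by apply: eq_bigr => t _; rewrite -mulr_sumr wk.
- move=> aB a'B aa' /= wpos.
  have wt : 0 < w t.
    rewrite lt_neqAle w_ge0 andbT eq_sym.
    by apply: contraTneq wpos => ->; rewrite mul0r ltxx.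
  have kt : k (X b t) s != 0.
    by apply: contraTneq wpos => ->; rewrite mulr0 ltxx.
  have [kle kge] := k_le _ _ kt.
  move: aB a'B aa'; rewrite !inE.
  case: eqP => [->|_] /=; case: eqP => [->|_] //= aB a'B aa'.
  + have a'b : a' = b by apply: b_uniq; rewrite // /cover_graph aa' orbT.
    by move: aa'; rewrite a'b; exact: kge.
  + have ab : a = b by apply: b_uniq; rewrite // /cover_graph aa'.
    by move: aa'; rewrite ab; exact: kle.
  + exact: Xmono.
rewrite !inE; case: eqP => [-> _|_] /= => [|aB].
  rewrite -k_col -(pair_big_dep predT (fun t s' => s' == s)
    (fun t s' => w t * k (X b t) s')) /=.
  under eq_bigr do rewrite big_pred1_eq.
  rewrite (partition_big (X b) predT) //=; apply: eq_bigr => x _.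
  rewrite -Xp // mulr_suml; apply: eq_big => [t|t /eqP ->] //.
rewrite -Xp // (eq_bigl (fun ts : T * S => (X a ts.1 == s) && true)); last first.
  by move=> ts; rewrite andbT.
rewrite -(pair_big_dep (fun t => X a t == s) (fun _ _ => true)
  (fun t s' => w t * k (X b t) s')) /=.
by apply: eq_bigr => t _; rewrite -mulr_sumr wk.
Qed.

(** [B] grows from a single point, where [S] with the law [p a0] is the probability space; it stays
    connected, so acyclicity leaves each new point a single neighbour in it. *)
Lemma realized_on_all : realized_on [set: A].
Proof.
have [a0 _|A0] := pickP (fun _ : A => true); last first.
  exists unit, (fun=> 1), (fun _ _ => x0); split=> [//||a|a]; last 2 first.
  - by have := A0 a.
  - by have := A0 a.
  by rewrite big_const card_unit /= addr0.
have start : connected_set [set a0] /\ realized_on [set a0].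
  split; first by move=> x y; rewrite !inE => /eqP -> /eqP ->.
  exists S, (p a0), (fun _ s => s); split=> // a s.
  by rewrite !inE => /eqP ->; rewrite big_pred1_eq.
suff grow n : forall B : {set A}, (#|~: B| <= n)%N -> a0 \in B -> connected_set B ->
    realized_on B -> realized_on [set: A].
  by case: start => conn; apply: (grow _ _ (leqnn _)); rewrite ?inE.
elim: n => [|n IHn] B Bn a0B B_conn realB.
  suff -> : [set: A] = B by [].
  move: Bn; rewrite leqn0 cards_eq0 => /eqP/(congr1 (@finset.setC _)).
  by rewrite finset.setCK finset.setC0 => ->.
have [allB|[a aB]] := finset.set_0Vmem (~: B).
  by apply: IHn realB => //; rewrite allB cards0.
(* A path from [a0] to a point outside [B] crosses the boundary of [B] somewhere. *)
have [b [c [bB cB bc]]] : exists b c, [/\ b \in B, c \notin B & cover_graph b c].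
  have /connectP[q a0q la] := A_connected a0 a.
  move: aB; rewrite inE la; elim: q (a0) a0B a0q {la} => [|z q IHq] b bB /=.
    by rewrite bB.
  case/andP=> bz zq; have [zB|zB _] := boolP (z \in B); first exact: IHq.
  by exists b, z.
apply: (IHn (c |: B)).
- rewrite -ltnS; apply: leq_trans Bn; apply/proper_card/properP; split.
    by rewrite finset.setCS finset.subsetUr.
  by exists c; rewrite !inE ?eqxx.
- by rewrite !inE a0B orbT.
- have sub x y : connect (within B) x y -> connect (within (c |: B)) x y.
    apply: connect_sub => u v /and3P[uB vB uv]; apply: connect1.
    by apply/and3P; split; rewrite ?finset.in_setU ?uB ?vB ?orbT.
  have cb : connect (within (c |: B)) c b.
    apply: connect1; apply/and3P; split; last by rewrite cover_graph_sym.
      by rewrite finset.in_setU finset.in_set1 eqxx.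
    by rewrite finset.in_setU bB orbT.
  have bc' : connect (within (c |: B)) b c.
    apply: connect1; apply/and3P; split=> //.
      by rewrite finset.in_setU bB orbT.
    by rewrite finset.in_setU finset.in_set1 eqxx.
  move=> x y; rewrite !inE => /orP[/eqP ->|xB] /orP[/eqP ->|yB].
  + exact: connect0.
  + by apply: connect_trans cb _; apply: sub; exact: B_conn.
  + by apply: connect_trans bc'; apply: sub; exact: B_conn.
  + by apply: sub; exact: B_conn.
- apply: (realized_on_extend bB) => // b' b'B cb'.
  by apply: (unique_attachment B_conn cB); rewrite // cover_graph_sym.
Qed.

End gluing.

(** * Cycles, diamonds and zigzags *)

Section cycles.
Variables (d : Order.disp_t) (A : finPOrderType d).
Implicit Types u v x y z : A.

Definition avoiding u v : rel A :=
  [rel x y | cover_graph x y &&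
    ~~ ((x == u) && (y == v) || (x == v) && (y == u))].

Lemma avoiding_sym u v : symmetric (avoiding u v).
Proof.
move=> x y; rewrite /avoiding [LHS]/= [RHS]/= cover_graph_sym orbC.
by rewrite (andbC (x == u)) (andbC (x == v)).
Qed.

Lemma path_avoiding u v z p : path (@cover_graph _ A) z p -> v \notin z :: p ->
  connect (avoiding u v) z (last z p).
Proof.
elim: p z => [|y p IHp] z /=; first by rewrite connect0.
case/andP=> zy yp; rewrite inE negb_or => /andP[vz vyp].
apply: connect_trans (IHp _ yp vyp); apply: connect1.
move: vyp; rewrite inE negb_or => /andP[vy _].
by rewrite /avoiding /= zy (eq_sym y v) (eq_sym z v) (negbTE vz) (negbTE vy) andbF.
Qed.

(** The first edge of the cycle is taken; the remaining ones join its ends. *)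
Lemma cycle_edge : has_cycle A ->
  exists u v, covers v u /\ connect (avoiding u v) u v.
Proof.
case=> [[|x [|y [|z q]]]] [] //= /andP[/and3P[xy yz zx] /and3P[]] + + _ _.
rewrite !inE !negb_or => /and3P[xy' xz xq] /andP[yz' yq].
have conn : connect (avoiding x y) y x.
  have yzx : avoiding x y y z.
    rewrite /avoiding /= yz eqxx (eq_sym z x) (negbTE xz).
    by rewrite (eq_sym y x) (negbTE xy').
  (* From [z] on, the cycle reaches [x] without returning to [y], so it cannot use the edge between
     [x] and [y]. *)
  apply: connect_trans (connect1 yzx) _.
  have -> : x = last z (rcons q x) by rewrite last_rcons.
  rewrite {1}last_rcons; apply: path_avoiding zx _.
  by rewrite inE mem_rcons inE !negb_or yz' (eq_sym y x) xy' yq.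
case/orP: xy => cov; last first.
  by exists x, y; rewrite (sym_connect_sym (avoiding_sym x y)).
exists y, x; split=> //; rewrite -(eq_connect (e := avoiding x y)) // => s t.
by rewrite /avoiding /= orbC.
Qed.

Definition diamond x y z w : Prop :=
  [/\ (x <= y <= w)%O, (x <= z <= w)%O, ~~ (y <= z)%O & ~~ (z <= y)%O].

(** Equivalently, every interval is a chain. *)
Definition diamond_free : Prop := forall x y z w, ~ diamond x y z w.

Hypothesis nd : diamond_free.

Lemma diamond_free_total x y z w : (x <= y)%O -> (y <= w)%O -> (x <= z)%O ->
  (z <= w)%O -> (y <= z)%O || (z <= y)%O.
Proof.
move=> xy yw xz zw; apply/negPn/negP; rewrite negb_or => /andP[yz zy].
by apply: (@nd x y z w); split; rewrite ?xy ?xz.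
Qed.

Variables u v : A.
Hypothesis uv : covers v u.

Let ltuv : (u < v)%O. Proof. by case/andP: uv. Qed.
Let leuv : (u <= v)%O := ltW ltuv.

Lemma covers_between z : (u <= z)%O -> (z <= v)%O -> z = u \/ z = v.
Proof.
case/andP: uv => _ /forallP/(_ z); rewrite !lt_neqAle => + uz zv.
rewrite uz zv !andbT negb_and !negbK (eq_sym u z).
by case/orP => /eqP; [left|right].
Qed.

(** The interval from [x] to [y] is a chain containing [u], [v] and [z], and no point lies strictly
    between [u] and [v]. *)
Lemma diamond_free_between x y z : (x <= u)%O -> (v <= y)%O -> (x <= z)%O ->
  (z <= y)%O -> (z <= u)%O || (v <= z)%O.
Proof.
move=> xu vy xz zy.
have /orP[->//|uz] := diamond_free_total xz zy xu (le_trans leuv vy).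
have /orP[zv|->] := diamond_free_total xz zy (le_trans xu leuv) vy;
  last by rewrite orbT.
by have [->|->] := covers_between uz zv; rewrite lexx ?orbT.
Qed.

(* The edge {u, v} is the only one over the edge of the bowtie between
   (false, false) and (true, false). *)
Definition fold_to_bowtie x : bool * bool :=
  if (v <= x)%O then (true, false)
  else if (x <= u)%O then (false, false)
  else if (u <= x)%O then (true, true)
  else if (x <= v)%O then (false, true)
  else ([exists b, (b <= v)%O && (b <= x)%O], true).

(** The delicate points are those incomparable to both [u] and [v]. Such a point goes to the top
    when it shares a lower bound with [v], which covers all those above a point below [u]; in that
    case it cannot lie under a point above [v], because intervals are chains. *)
Lemma fold_to_bowtie_mono x y : (x <= y)%O ->
  bowtie_le (fold_to_bowtie x) (fold_to_bowtie y).
Proof.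
move=> xy; rewrite /fold_to_bowtie.
have [vx|vx] := ifPn; first by rewrite (le_trans vx xy).
have [xu|xu] := ifPn.
  have [//|vy] := ifPn; have [//|yu] := ifPn; have [//|uy] := ifPn.
  have [yv|yv] := ifPn.
    by have := diamond_free_between xu (lexx v) xy yv; rewrite (negbTE yu) (negbTE vy).
  rewrite /bowtie_le /=; case: existsP => // -[].
  by exists x; rewrite xy (le_trans xu leuv).
have [ux|ux] := ifPn.
  rewrite (le_trans ux xy); have [vy|vy] := ifPn.
    by have := diamond_free_between (lexx u) vy ux xy; rewrite (negbTE xu) (negbTE vx).
  by rewrite (negbTE (contraNN (le_trans xy) xu)).
have [xv|xv] := ifPn.
  have [//|vy] := ifPn; rewrite (negbTE (contraNN (le_trans xy) xu)).
  have [//|uy] := ifPn; have [//|yv] := ifPn;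
    by rewrite /bowtie_le; case: [exists _, _].
case: existsP => [[b /andP[bv bx]]|_] /=.
  have [vy|vy] := ifPn.
    by have := diamond_free_total bv vy bx xy; rewrite (negbTE vx) (negbTE xv).
  rewrite (negbTE (contraNN (le_trans xy) xu)); have [//|uy] := ifPn.
  rewrite (negbTE (contraNN (le_trans xy) xv)).
  by case: existsP => // -[]; exists b; rewrite bv (le_trans bx).
have [//|vy] := ifPn; rewrite (negbTE (contraNN (le_trans xy) xu)).
have [//|uy] := ifPn; have [//|yv] := ifPn;
  by rewrite /bowtie_le; case: [exists _, _].
Qed.

(** Such a pair would satisfy [x <= u < v <= y]; being a cover, it would be [u] and [v]
    themselves. *)
Lemma fold_to_bowtie_edge x y : avoiding u v x y -> (x <= y)%O ->
  ~ (fold_to_bowtie x = (false, false) /\ fold_to_bowtie y = (true, false)).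
Proof.
case/andP=> cxy exy xy [].
rewrite /fold_to_bowtie; case: ifPn => // vx; case: ifPn => [xu _|xu]; last first.
  by case: ifP => // _; case: ifP.
case: ifPn => [vy _|vy]; last by case: ifP => // _; case: ifP => // _; case: ifP.
have cov : covers y x.
  by case/orP: cxy => // /andP[/lt_geF]; rewrite xy.
case/andP: cov => _ /forallP between.
have xuE : x = u.
  apply/eqP; have := between u.
  by rewrite (lt_le_trans ltuv vy) andbT lt_neqAle xu andbT negbK.
have vyE : v = y.
  by apply/eqP; have := between v; rewrite xuE ltuv /= lt_neqAle vy andbT negbK.
by move: exy; rewrite xuE vyE !eqxx.
Qed.

Lemma fold_to_bowtie_u : fold_to_bowtie u = (false, false).
Proof. by rewrite /fold_to_bowtie (lt_geF ltuv) lexx. Qed.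

Lemma fold_to_bowtie_v : fold_to_bowtie v = (true, false).
Proof. by rewrite /fold_to_bowtie lexx. Qed.

End cycles.

(** * Crowns from bowties and from cycles *)

Section crowns.
Variables (d : Order.disp_t) (S : finPOrderType d).

(* The zigzag x0 <= y0 >= x1 <= ... >= xn <= yn >= x0, with [xs] and [ys] listing
   x2, ..., xn and y1, ..., y(n-1), in which the comparabilities of x0, y0 and yn
   are controlled; for n = 1 it is an induced bowtie. *)
Record crown (x0 x1 : S) (xs : seq S) (y0 yn : S) (ys : seq S) : Prop := Crown {
  crown_x0y0 : (x0 <= y0)%O;
  crown_x0yn : (x0 <= yn)%O;
  crown_x1y0 : (x1 <= y0)%O;
  crown_shift : all2 <=%O xs ys;
  crown_straight : all2 <=%O (x1 :: xs) (rcons ys yn);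
  crown_x0_ys : forall y, y \in ys -> ~~ (x0 <= y)%O;
  crown_x0_xs : forall x, x \in x1 :: xs -> ~~ (x0 <= x)%O;
  crown_xs_x0 : forall x, x \in x1 :: xs -> ~~ (x <= x0)%O;
  crown_y0_ys : forall y, y \in rcons ys yn -> ~~ (y0 <= y)%O;
  crown_yn_ys : forall y, y \in y0 :: ys -> ~~ (yn <= y)%O
}.

Definition has_crown : Prop :=
  exists x0 x1 xs y0 yn ys, crown x0 x1 xs y0 yn ys.

Lemma bowtie_crown : has_induced bowtie S -> has_crown.
Proof.
case=> U [f [_ fle]].
pose g (p : bowtie) := val (f p); have gle p q : (g p <= g q)%O = bowtie_le p q.
  by rewrite -[RHS]/(p <= q)%O fle.
exists (g (false, false)), (g (false, true)), [::].
exists (g (true, false)), (g (true, true)), [::].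
by split; rewrite /= ?gle // => y; rewrite inE => /eqP ->; rewrite gle.
Qed.

Section crown_of_cycle.
Hypothesis nd : diamond_free S.
Variables u v : S.
Hypothesis uv : covers v u.

(* As intervals are chains, this is the order generated by all cover pairs but
   {u, v}. *)
Definition le_off (x y : S) : bool :=
  (x <= y)%O && ~~ ((x <= u)%O && (v <= y)%O).

(** A zigzag of [le_off] steps leading from below [u] to above [v]; the relation [u < v] closes it
    up. *)
Definition fence n (x y : nat -> S) : Prop :=
  [/\ forall i, (i <= n)%N -> le_off (x i) (y i),
      forall i, (i < n)%N -> le_off (x i.+1) (y i),
      (x 0%N <= u)%O & (v <= y n)%O].

Let ltuv : (u < v)%O. Proof. by case/andP: uv. Qed.

Lemma le_off_refl : reflexive le_off.
Proof.
move=> x; rewrite /le_off lexx /=; apply/negP => /andP[xu /le_trans/(_ xu)].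
by rewrite (lt_geF ltuv).
Qed.

Lemma le_off_covers x y : avoiding u v x y -> covers y x -> le_off x y.
Proof.
case/andP=> _ exy /andP[xy /forallP between]; rewrite /le_off (ltW xy) /=.
apply: contra exy => /andP[xu vy].
have xuE : x = u.
  apply/eqP; have := between u.
  by rewrite (lt_le_trans ltuv vy) andbT lt_neqAle xu andbT negbK.
have vyE : v = y.
  by apply/eqP; have := between v; rewrite xuE ltuv /= lt_neqAle vy andbT negbK.
by rewrite xuE vyE !eqxx.
Qed.

(** The fence follows the path: it starts constant at [u], and its last upper point is the current
    vertex. *)
Lemma fence_exists : connect (avoiding u v) u v -> exists n x y, fence n x y.
Proof.
case/connectP=> q uq lq.
suff grow z : path (avoiding u v) z q ->
    (exists n x y, [/\ forall i, (i <= n)%N -> le_off (x i) (y i),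
      forall i, (i < n)%N -> le_off (x i.+1) (y i), (x 0%N <= u)%O & y n = z]) ->
    exists n x y, [/\ forall i, (i <= n)%N -> le_off (x i) (y i),
      forall i, (i < n)%N -> le_off (x i.+1) (y i), (x 0%N <= u)%O & y n = last z q].
  have [|n [x [y [h1 h2 h3 h4]]]] := grow _ uq.
    by exists 0, (fun=> u), (fun=> u); split=> // i _; exact: le_off_refl.
  by exists n, x, y; split; rewrite // h4 -lq.
elim: q z {uq lq} => [|t q IHq] z //= /andP[zt tq] [n [x [y [h1 h2 h3 h4]]]].
apply: IHq tq _.
(* [p1] is the lower end of the edge between [z] and [t], so one of the two steps is trivial. *)
have [p1 p2] : exists p1, le_off p1 t /\ le_off p1 z.
  case/andP: (zt) => /orP[tz|zt'] _.
    exists t; split; first exact: le_off_refl.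
    by apply: le_off_covers => //; rewrite avoiding_sym.
  by exists z; split; [exact: le_off_covers|exact: le_off_refl].
exists n.+1, (fun i => if (i <= n)%N then x i else p1),
  (fun i => if (i <= n)%N then y i else t).
split=> [i|i||] /=.
- by case: ifP => [/h1 //|_ _]; case: p2.
- rewrite ltnS => le_in; rewrite le_in; have [->|ine] := eqVneq i n.
    by rewrite ltnn h4; case: p2.
  have ilt : (i < n)%N by rewrite ltn_neqAle ine.
  by rewrite ilt; exact: h2.
- by [].
- by rewrite ltnn.
Qed.

Section minimal_fence.
Variables (n : nat) (x y : nat -> S).
Hypothesis fxy : fence n x y.
Hypothesis fmin : forall m x' y', fence m x' y' -> (n <= m)%N.

Let le_xy i : (i <= n)%N -> (x i <= y i)%O.
Proof. by case: fxy => h _ _ _ /h/andP[]. Qed.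

Let le_xSy i : (i < n)%N -> (x i.+1 <= y i)%O.
Proof. by case: fxy => _ h _ _ /h/andP[]. Qed.

Let x0u : (x 0%N <= u)%O. Proof. by case: fxy. Qed.
Let vyn : (v <= y n)%O. Proof. by case: fxy. Qed.

(** Otherwise dropping everything before index [i] would leave a shorter fence. *)
Lemma fence_x_le i : (i <= n)%N -> (x i <= u)%O -> i = 0.
Proof.
case: fxy => h1 h2 _ _ le_in xiu; apply/eqP; rewrite -leqn0.
suff /fmin : fence (n - i) (fun k => x (i + k)%N) (fun k => y (i + k)%N) by lia.
split=> [k kn|k kn||].
- by apply: h1; lia.
- by rewrite addnS; apply: h2; lia.
- by rewrite addn0.
- by rewrite subnKC.
Qed.

(** Otherwise the fence could already stop at index [i]. *)
Lemma fence_y_ge i : (i <= n)%N -> (v <= y i)%O -> i = n.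
Proof.
case: fxy => h1 h2 _ _ le_in vyi; apply/eqP; rewrite eqn_leq le_in /=.
suff /fmin : fence i x y by [].
by split=> // k ki; [apply: h1|apply: h2]; lia.
Qed.

Lemma fence_gt0 : (0 < n)%N.
Proof.
case: fxy => h1 _ _ _; rewrite lt0n; apply/eqP => n0.
by have /andP[_] := h1 0%N (leq0n n); rewrite x0u /= -{1}n0 vyn.
Qed.

Lemma fence_x0_y j : (0 < j < n)%N -> ~~ (x 0%N <= y j)%O.
Proof.
case/andP=> j0 jn; apply/negP => x0y; case: fxy => h1 h2 _ _.
have vy : ~~ (v <= y j)%O by apply/negP => /(fence_y_ge (ltnW jn)); lia.
(* The shortcut goes from [x 0] straight to [y j]; it is a [le_off] step because [y j] is not above
   [v]. *)
suff /fmin : fence (n - j)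
    (fun k => if k == 0%N then x 0%N else x (j + k)%N) (fun k => y (j + k)%N).
  by lia.
split=> [[|k] kn|k kn||] //=.
- by rewrite addn0 /le_off x0y (negbTE vy) andbF.
- by apply: h1; lia.
- by rewrite addnS; apply: h2; lia.
- by rewrite subnKC // ltnW.
Qed.

Lemma fence_x_x0 i : (0 < i <= n)%N -> ~~ (x i <= x 0%N)%O.
Proof.
case/andP=> i0 le_in; apply/negP => xx0.
by have := fence_x_le le_in (le_trans xx0 x0u); lia.
Qed.

Lemma fence_x0_x i : (0 < i <= n)%N -> ~~ (x 0%N <= x i)%O.
Proof.
case/andP=> i0; rewrite leq_eqVlt => /orP[/eqP inE'|lt_in];
  apply/negP => x0x; last first.
  have := fence_x0_y (j := i); rewrite i0 lt_in => /(_ isT)/negP; apply.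
  exact: le_trans x0x (le_xy (ltnW lt_in)).
have le_in : (i <= n)%N by rewrite inE'.
have xyn : (x i <= y n)%O by rewrite -inE' le_xy.
(* Only [i = n] is left, where [x n] lies between [x 0] and [y n]: being below [u] or above [v], it
   would allow a shorter fence. *)
have /orP[xu|vx] := diamond_free_between nd uv x0u vyn x0x xyn.
  by have := fence_x_le le_in xu; lia.
have xy1 : (x i <= y i.-1)%O by rewrite -{1}(prednK i0) le_xSy //; lia.
have le_i1n : (i.-1 <= n)%N by lia.
by have := fence_y_ge le_i1n (le_trans vx xy1); lia.
Qed.

Lemma fence_y0_y j : (0 < j <= n)%N -> ~~ (y 0%N <= y j)%O.
Proof.
case/andP=> j0; rewrite leq_eqVlt => /orP[/eqP jnE|lt_jn];
  apply/negP => y0y; last first.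
  have := fence_x0_y (j := j); rewrite j0 lt_jn => /(_ isT)/negP; apply.
  exact: le_trans (le_xy (leq0n _)) y0y.
have y0yn : (y 0%N <= y n)%O by rewrite -jnE.
have n0 := fence_gt0.
have /orP[yu|vy] := diamond_free_between nd uv x0u vyn (le_xy (leq0n _)) y0yn.
  by have := fence_x_le n0 (le_trans (le_xSy n0) yu).
by have := fence_y_ge (leq0n _) vy; lia.
Qed.

Lemma fence_yn_y j : (j < n)%N -> ~~ (y n <= y j)%O.
Proof.
move=> jn; apply/negP => yy.
by have := fence_y_ge (ltnW jn) (le_trans vyn yy); lia.
Qed.

Lemma fence_crown : has_crown.
Proof.
have n0 := fence_gt0; have [m nE] : exists m, n = m.+1 by exists n.-1; lia.
have all2_map (f g : nat -> S) s : (forall i, i \in s -> (f i <= g i)%O) ->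
    all2 <=%O (map f s) (map g s).
  elim: s => //= i s IHs h; rewrite h ?mem_head //=; apply: IHs => k ks.
  by apply: h; rewrite inE ks orbT.
have ysE : rcons (map y (iota 1 m)) (y n) = map y (iota 1 n).
  by rewrite nE -(addn1 m) iotaD map_cat cats1 add1n addn1.
have xsE : x 1%N :: map x (iota 2 m) = map x (iota 1 n) by rewrite nE.
exists (x 0%N), (x 1%N), (map x (iota 2 m)), (y 0%N), (y n), (map y (iota 1 m)).
split; rewrite ?ysE ?xsE //.
- exact: le_xy.
(* The only relation of the crown that passes through the edge from [u] to [v]. *)
- exact: le_trans x0u (le_trans (ltW ltuv) vyn).
- exact: le_xSy.
- rewrite (_ : map x _ = map (fun i => x i.+1) (iota 1 m)); last first.
    by rewrite -[2%N]/(1 + 1)%N iotaDl -map_comp; apply: eq_map => i /=; rewrite add1n.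
  by apply: all2_map => i; rewrite mem_iota => ?; apply: le_xSy; lia.
- by apply: all2_map => i; rewrite mem_iota => ?; apply: le_xy; lia.
- by move=> _ /mapP[i + ->]; rewrite mem_iota => ?; apply: fence_x0_y; lia.
- by move=> _ /mapP[i + ->]; rewrite mem_iota => ?; apply: fence_x0_x; lia.
- by move=> _ /mapP[i + ->]; rewrite mem_iota => ?; apply: fence_x_x0; lia.
- by move=> _ /mapP[i + ->]; rewrite mem_iota => ?; apply: fence_y0_y; lia.
- move=> z; rewrite inE => /orP[/eqP ->|/mapP[i + ->]]; first exact: fence_yn_y.
  by rewrite mem_iota => ?; apply: fence_yn_y; lia.
Qed.

End minimal_fence.
End crown_of_cycle.

Lemma cycle_crown : diamond_free S -> has_cycle S -> has_crown.
Proof.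
move=> nd /cycle_edge[u [v [uv /(fence_exists uv) fences]]].
have exP : exists n, `[< exists x y, fence u v n x y >].
  by case: fences => n fn; exists n; apply/asboolP.
have [n /asboolP[x [y fxy]] fmin] := ex_minnP exP.
apply: (fence_crown nd uv fxy) => m x' y' fm.
by apply: fmin; apply/asboolP; exists x', y'.
Qed.

End crowns.

(** * Realizations on finite probability spaces *)

Section finite_probability.
Local Open Scope classical_set_scope.
Variable R : realType.

Section weights.
Variables (T : finType) (t0 : T) (w : T -> R).
Hypothesis w_ge0 : forall t, 0 <= w t.
Hypothesis w_sum1 : \sum_t w t = 1.

Let term (k : nat) : {measure set (discrete t0) -> \bar R} :=
  mscale (NngNum (w_ge0 (nth t0 (enum T) k)))
    (dirac (nth t0 (enum T) k : discrete t0)).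

Definition weighted : set (discrete t0) -> \bar R := msum term #|T|.

HB.instance Definition _ := Measure.on weighted.

Lemma weightedE (B : set T) : weighted B = (\sum_(t | t \in B) w t)%:E.
Proof.
rewrite /weighted /msum -sumEFin [RHS]big_mkcond /= -[RHS]big_enum /=.
rewrite (big_nth t0) big_mkord -cardE; apply: eq_bigr => k _.
rewrite /= /mscale /= diracE; case: ifP => _ /=; first by rewrite mule1.
by rewrite mule0.
Qed.

Lemma weightedT : weighted [set: discrete t0] = 1%:E.
Proof.
rewrite weightedE -w_sum1; congr EFin; apply: eq_bigl => t.
exact/mem_set.
Qed.

End weights.

Lemma exists_probability (T : finType) (t0 : T) (w : T -> R) :
    (forall t, 0 <= w t) -> \sum_t w t = 1 ->
  exists P : probability (discrete t0) R,
    forall B : set T, P B = (\sum_(t | t \in B) w t)%:E.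
Proof.
move=> w_ge0 w_sum1.
pose Q : probability (discrete t0) R :=
  HB.pack_for (probability (discrete t0) R) (@weighted T t0 w w_ge0)
   (Measure_isProbability.Build _ _ _ _ (weightedT t0 w_ge0 w_sum1)).
by exists Q => B; exact: weightedE.
Qed.

Section point_masses.
Variables (S : finType) (x0 : S) (P : probability (discrete x0) R).

Definition mass (s : S) : R := fine (P [set s]).

Lemma mass_ge0 s : 0 <= mass s.
Proof. exact/fine_ge0/measure_ge0. Qed.

Lemma probability_mass (B : set S) : P B = (\sum_(s | s \in B) mass s)%:E.
Proof.
have {1}-> : B = \bigcup_(s in B) [set s].
  by apply/seteqP; split=> [s Bs|s [t Bt ->] //]; exists s.
rewrite measure_fin_bigcup //; last 2 first.
- exact: finite_finset.
- by move=> i j _ _ [x [-> ->]].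
rewrite (fsbigE (enum (mem B))) ?enum_uniq //=; last 2 first.
- by move=> s /=; rewrite mem_enum inE.
- by move=> s Bs; rewrite mem_enum (mem_set Bs).
rewrite big_enum_cond /= -sumEFin; apply: eq_big => [s|s _]; first exact: andbb.
by rewrite fineK // fin_num_measure.
Qed.

Lemma mass_sum1 : \sum_s mass s = 1.
Proof.
apply: EFin_inj; rewrite -[RHS](probability_setT P) probability_mass.
by congr EFin; apply: eq_bigl => s; apply/esym/mem_set.
Qed.

End point_masses.

Section finite_realization.
Variables (dA dS : Order.disp_t).
Variables (A : finPOrderType dA) (S : finPOrderType dS) (x0 : S).
Variable P : A -> probability (discrete x0) R.

Definition finitely_realizable : Prop :=
  exists (T : finType) (w : T -> R) (X : A -> T -> S),
    [/\ forall t, 0 <= w t,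
        \sum_t w t = 1,
        forall a b t, (a <= b)%O -> 0 < w t -> (X a t <= X b t)%O &
        forall a s, \sum_(t | X a t == s) w t = mass (P a) s].

Lemma finitely_realizable_realizable :
  finitely_realizable -> realizably_monotone P.
Proof.
case=> T [w [X [w_ge0 w_sum1 Xmono Xmass]]].
have [t0 _|T0] := pickP (fun _ : T => true); last first.
  by have := @oner_neq0 R; rewrite -w_sum1 big1 ?eqxx // => t; have := T0 t.
have [mu muE] := exists_probability t0 w_ge0 w_sum1.
(* Realizations must be monotone at every point of the space, so points of weight zero receive a
   constant value. *)
pose Y a (t : discrete t0) : discrete x0 := if 0 < w t then X a t else x0.
have mY a : measurable_fun setT (Y a) by [].
exists _, (discrete t0), mu, (fun a => mfun_Sub (mem_set (mY a))); split.
  by move=> a b ab t; rewrite /= /Y; case: ifP => // wt; exact: Xmono.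
move=> a B; rewrite /distribution /pushforward /= muE probability_mass.
congr EFin.
under [RHS]eq_bigr do rewrite -Xmass.
rewrite (exchange_big_dep (fun t => X a t \in B)) /=; last first.
  by move=> s t sB /eqP ->.
rewrite [LHS]big_mkcond [RHS]big_mkcond; apply: eq_bigr => t _.
have [-> |wt0] := eqVneq (w t) 0.
  by rewrite if_same big1 ?if_same.
have wt : 0 < w t by rewrite lt_neqAle eq_sym wt0 w_ge0.
have -> : (t \in Y a @^-1` B) = (X a t \in B).
  by apply/idP/idP; rewrite !inE /Y /= wt.
case: ifP => // XB; rewrite (big_pred1 (X a t)) // => s /=.
by rewrite eq_sym andbC; case: eqP => //= ->.
Qed.

(** The joint law is pushed forward to the finite set of all functions from [A] to [S]. *)
Lemma realizable_finitely_realizable :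
  realizably_monotone P -> finitely_realizable.
Proof.
case=> d [T [mu [X [Xmono XP]]]].
pose h0 : {ffun A -> S} := [ffun=> x0].
pose J (t : T) : discrete h0 := [ffun a => X a t : S].
have mJ : measurable_fun setT J.
  move=> _ B _; rewrite setTI.
  have -> : J @^-1` B = \bigcup_(h in B) \bigcap_a (X a @^-1` [set h a]).
    apply/seteqP; split=> [t Bt|t [h Bh Xh]].
      by exists (J t) => // a _; rewrite /= ffunE.
    suff Jh : J t = h by rewrite /= Jh.
      by apply/ffunP => a; rewrite ffunE; apply: Xh.
  apply: fin_bigcup_measurable => [|h _].
    exact: (@finite_finset {ffun A -> S}).
  apply: fin_bigcap_measurable => [|a _]; first exact: finite_finset.
  by rewrite -[X in measurable X]setTI; exact: measurable_funP.
pose Q : probability (discrete h0) R := distribution mu (mfun_Sub (mem_set mJ)).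
exists {ffun A -> S}, (mass Q), (fun a (h : {ffun A -> S}) => h a); split.
- exact: mass_ge0.
- exact: mass_sum1.
- move=> a b h ab hpos.
  (* A function of positive mass is the value of [J] at some [t], and so inherits monotonicity. *)
  have [[t Jt]|no] := pselect (exists t, J t = h).
    by move: {hpos} h Jt => _ <-; rewrite !ffunE; exact: Xmono.
  move: hpos; rewrite /mass /Q /= /distribution /pushforward /=.
  rewrite (_ : J @^-1` [set h] = set0) ?measure0 ?ltxx //.
  by apply/seteqP; split=> // t Jt; apply: no; exists t.
move=> a s; apply: EFin_inj.
have <- : Q [set h : {ffun A -> S} | h a = s] = (mass (P a) s)%:E.
  rewrite /mass fineK ?fin_num_measure // -XP.
  rewrite /Q /= /distribution /pushforward /=; congr (mu _).
  by apply/seteqP; split=> t /=; rewrite ffunE.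
rewrite probability_mass; congr EFin; apply: eq_bigl => h.
by apply/eqP/idP; rewrite inE.
Qed.

End finite_realization.

End finite_probability.

(** * Systems that are not realizable *)

Section uniform_systems.
Variables (R : realType) (dA dS : Order.disp_t).
Variables (A : finPOrderType dA) (S : finPOrderType dS).

(** An explicit coupling of the uniform laws on the two lists, repetitions counted. *)
Definition matched (k l : seq S) : Prop :=
  exists2 l' : seq S, perm_eq l' l & all2 <=%O k l'.

Lemma all2_refl (k : seq S) : all2 <=%O k k.
Proof. by elim: k => //= x k ->; rewrite lexx. Qed.

Lemma matched_refl (k : seq S) : matched k k.
Proof. by exists k => //; exact: all2_refl. Qed.

Lemma matched_count (k l : seq S) (U : pred S) :
    (forall x y, U x -> (x <= y)%O -> U y) -> matched k l ->
  (count U k <= count U l)%N.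
Proof.
move=> Uup [l' /permP <-]; elim: k l' => [|x k IHk] [|y l'] //= /andP[xy /IHk h].
by apply: leq_add h; case Ux: (U x) => //; rewrite (Uup _ _ Ux xy).
Qed.

Lemma sum_count_mem (U : pred S) (k : seq S) :
  \sum_(s | U s) (count_mem s k)%:R = (count U k)%:R :> R.
Proof.
elim: k => [|x k IHk] /=; first by rewrite big1.
under eq_bigr do rewrite natrD.
rewrite big_split /= IHk natrD; congr (_ + _).
rewrite big_mkcond (bigD1 x) //= eqxx big1 ?addr0 => [|s /negbTE sx].
  by case: (U x).
by rewrite eq_sym sx if_same.
Qed.

(* What remains of a joint law of random variables uniform on the lists [L a] once
   restricted to a support T and stripped of its weights; the third clause says
   that an event included in another one of the same mass is equal to it. *)
Definition support_realizes (L : A -> seq S) (T : Type) (X : A -> T -> S) : Prop :=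
  [/\ forall a b t, (a <= b)%O -> (X a t <= X b t)%O,
      forall a t, X a t \in L a,
      forall a b (E F : pred S), (forall t, E (X a t) -> F (X b t)) ->
        count E (L a) = count F (L b) -> forall t, F (X b t) -> E (X a t) &
      forall a (E : pred S), has E (L a) -> exists t, E (X a t)].

(** Matched lists make the uniform laws stochastically monotone; a finite realization of them is
    then restricted to its points of positive weight. *)
Lemma uniform_system (L : A -> seq S) (n : nat) (x0 : S) :
    (forall a, size (L a) = n.+1) ->
    (forall a b, (a <= b)%O -> matched (L a) (L b)) ->
    monotonicity_equivalence R A S ->
  exists T (X : A -> T -> S), support_realizes L X.
Proof.
move=> L_size L_matched equivalence.
pose p a s : R := (count_mem s (L a))%:R / n.+1%:R.
have sum_p a (U : pred S) : \sum_(s | U s) p a s = (count U (L a))%:R / n.+1%:R.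
  by rewrite -mulr_suml sum_count_mem.
have n_neq0 : n.+1%:R != 0 :> R by rewrite pnatr_eq0.
have /choice[P PE] : forall a, exists P : probability (discrete x0) R,
    forall B : set S, P B = (\sum_(s | s \in B) p a s)%:E.
  move=> a; apply: exists_probability => [s|]; first by rewrite divr_ge0.
  by rewrite sum_p count_predT L_size divff.
have massE a s : mass (P a) s = p a s.
  rewrite /mass PE /= (big_pred1 s) // => t.
  by apply/idP/eqP; rewrite inE.
have P_mono : stochastically_monotone P.
  move=> a b ab U Uup; rewrite !PE lee_fin !sum_p ler_wpM2r ?invr_ge0 // ler_nat.
  apply: matched_count (L_matched _ _ ab) => x y; rewrite !inE; exact: Uup.
have [T [w [X [w_ge0 _ Xmono Xp]]]] :=
  realizable_finitely_realizable (equivalence x0 P P_mono).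
have law a (E : pred S) : \sum_(t | E (X a t)) w t = (count E (L a))%:R / n.+1%:R.
  rewrite (partition_big (X a) E) //= -sum_p; apply: eq_bigr => s Es.
  rewrite -massE -Xp; apply: eq_bigl => t.
  by case: eqP => [->|_]; rewrite ?Es ?andbF.
have N_gt0 : 0 < n.+1%:R^-1 :> R by rewrite invr_gt0 ltr0n.
exists {t | 0 < w t}, (fun a t => X a (sval t)); split.
- by move=> a b [t wt] ab; exact: Xmono.
- move=> a [t wt] /=; apply: contraT => XL; move: wt; rewrite lt_def.
  suff -> : w t = 0 by rewrite eqxx.
  apply: (psumr_eq0P (P := fun t => X a t \notin L a) (fun t _ => w_ge0 t)) => //.
  rewrite (law a (fun s => s \notin L a)) (eq_in_count (a2 := pred0)).
    by rewrite count_pred0 mul0r.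
  by move=> s /= ->.
- move=> a b E F EF cEF [t0 wt0] /= Ft0; apply: contraT => Et0.
  (* If [F] held at [t0] without [E], the mass of [E] would be at most that of [F] minus the
     positive [w t0]. *)
  have := law b F; rewrite -cEF -law (bigD1 t0) //= => sumE.
  suff : \sum_(t | E (X a t)) w t <= \sum_(t | F (X b t) && (t != t0)) w t.
    by rewrite -sumE gerDr leNgt wt0.
  rewrite big_mkcond [leRHS]big_mkcond; apply: ler_sum => t _.
  have [-> |t_t0] := eqVneq t t0; first by rewrite (negbTE Et0) andbF.
  case: ifP => Et; last by case: ifP.
  have [-> |wt] := eqVneq (w t) 0; first by case: ifP.
  have wt_gt0 : 0 < w t by rewrite lt_def wt w_ge0.
  by rewrite (EF (exist _ t wt_gt0) Et).
- move=> a E; rewrite has_count => cE; apply: contrapT => no.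
  have : 0 < \sum_(t | E (X a t)) w t by rewrite law mulr_gt0 // ltr0n.
  rewrite big1 ?ltxx // => t Et; apply/eqP; apply: contraT => wt; case: no.
  have wt_gt0 : 0 < w t by rewrite lt_def wt w_ge0.
  by exists (exist _ t wt_gt0).
Qed.

End uniform_systems.

Lemma connect_preserves (T : finType) (e : rel T) (Q : T -> Prop) x y :
  (forall a b, e a b -> Q a -> Q b) -> connect e x y -> Q x -> Q y.
Proof.
move=> eQ /connectP[p xp ->]; elim: p x xp => //= z p IHp x /andP[xz zp] Qx.
exact: IHp zp (eQ _ _ xz Qx).
Qed.

(** * Propagation of events around a cycle *)

Section obstructions.
Variables (dA dS : Order.disp_t) (A : finPOrderType dA) (S : finPOrderType dS).

Section bowtie_index.
Variables (l : bool * bool -> seq S) (D U0 U1 : pred S).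
Hypothesis D_down : forall x y, D y -> (x <= y)%O -> D x.
Hypothesis U0_up : forall x y, U0 x -> (x <= y)%O -> U0 y.
Hypothesis U1_up : forall x y, U1 x -> (x <= y)%O -> U1 y.
Hypothesis DU0 : forall x, D x -> ~~ U0 x.
Hypothesis DU1 : forall x, D x -> ~~ U1 x.
Let m0 := (false, false). Let m1 := (false, true).
Let M0 := (true, false). Let M1 := (true, true).
Hypothesis D_count : count D (l m1) = count D (l M0).
Hypothesis U0_count : count U0 (l m0) = count U0 (l M1).
Hypothesis U1_count : count U1 (l m1) = count U1 (l M1).
Hypothesis DU0_count : count D (l m1) = count U0 (l M1).
Hypothesis D_U0 : forall s t, s \in l m1 -> t \in l M1 -> (s <= t)%O ->
  D s -> U0 t || U1 t.
Hypothesis U0_m0 : has U0 (l m0).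

(* Along the path from u to v, the event [U0 (X u)] coincides with [U0 (X a)] or
   [D (X a)], according to the image of a. *)
Let invariant (i : bool * bool) : pred S := if i.1 == i.2 then U0 else D.

(** The path turns the event [U0 (X u)] into [D (X v)]. As [X u <= X v] and [D] is a down-set, [D]
    and [U0] would then hold together at [u]. *)
Lemma bowtie_obstruction (u v : A) (r : A -> bool * bool) (T : Type)
    (X : A -> T -> S) :
    covers v u -> connect (avoiding u v) u v ->
    (forall a b, (a <= b)%O -> bowtie_le (r a) (r b)) ->
    (forall a b, avoiding u v a b -> (a <= b)%O -> ~ (r a = m0 /\ r b = M0)) ->
    r u = m0 -> r v = M0 ->
  ~ support_realizes (fun a => l (r a)) X.
Proof.
move=> uv conn r_mono r_avoid ru rv [Xmono Xin Xtight Xhas].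
have step a b t : avoiding u v a b -> (a <= b)%O ->
    invariant (r a) (X a t) = invariant (r b) (X b t).
  move=> ab leab; have Xle s := Xmono a b s leab.
  have up (U : pred S) : (forall x y, U x -> (x <= y)%O -> U y) ->
      count U (l (r a)) = count U (l (r b)) -> U (X a t) = U (X b t).
    move=> Uup cU; apply/idP/idP; first by move=> h; exact: Uup h (Xle t).
    by apply: (Xtight a b U U _ cU) => s h; exact: Uup h (Xle s).
  have down : count D (l (r a)) = count D (l (r b)) -> D (X a t) = D (X b t).
    move=> cD; apply/idP/idP; last by move=> h; exact: D_down h (Xle t).
    by apply: (Xtight b a D D _ (esym cD)) => s h; exact: D_down h (Xle s).
  move: (r_mono _ _ leab) (r_avoid _ _ ab leab) up down (Xin a) (Xin b) (Xtight a b).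
  rewrite /bowtie_le /invariant.
  have [<- _ _ up down _ _ _|_] := eqVneq (r a) (r b).
    by case: ifP => _; [exact: up|exact: down].
  case: (r a) => [[] i] //=; case: (r b) => [[] j] //= _.
  case: i j => -[] /= avoid up down Xa Xb tight.
  (* Over the edge from [m1] to [M1], the events [U1] coincide; so [D] below excludes [U1] above and
     forces [U0], and equal masses make this implication an equivalence. *)
  - have D_imp s : D (X a s) -> U0 (X b s).
      move=> Ds; have := D_U0 (Xa s) (Xb s) (Xle s) Ds; case/orP => // U1b.
      have := DU1 Ds; rewrite (tight U1 U1) //; first by move=> s'; move/U1_up; apply.
    apply/idP/idP; first exact: D_imp.
    exact: tight.
  - exact: down.
  - exact: up.
  - by case: avoid.
have [t U0t] : exists t, U0 (X u t) by apply: Xhas; rewrite ru.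
have Dv : D (X v t).
  suff : invariant (r v) (X v t) by rewrite rv.
  apply: (connect_preserves (Q := fun a => invariant (r a) (X a t)) _ conn).
    move=> a b ab; have [leab|leba] : (a <= b)%O \/ (b <= a)%O.
      by case/andP: ab => /orP[] /andP[/ltW]; [right|left].
    - by rewrite (step _ _ _ ab leab).
    - by rewrite -(step b a) // avoiding_sym.
  by rewrite ru.
have := DU0 (D_down Dv (Xmono _ _ t (ltW (proj1 (andP uv))))).
by rewrite U0t.
Qed.

End bowtie_index.

(** Where [D] holds at [a] it still holds at [b] and [c], while [U0] or [U1] holds at [d]. By equal
    masses, [U0] descends from [d] to [c] and [U1] from [d] to [b], both disjoint from [D]. *)
Lemma crown_diamond_obstruction (l : bool * bool -> seq S) (D U0 U1 : pred S)
    (a b c d : A) (T : Type) (X : A -> T -> S) :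
    (forall x y, D y -> (x <= y)%O -> D x) ->
    (forall x y, U0 x -> (x <= y)%O -> U0 y) ->
    (forall x y, U1 x -> (x <= y)%O -> U1 y) ->
    (forall x, D x -> ~~ U0 x) -> (forall x, D x -> ~~ U1 x) ->
    count D (l (false, false)) = count D (l (true, false)) ->
    count D (l (false, false)) = count D (l (false, true)) ->
    count U1 (l (true, false)) = count U1 (l (true, true)) ->
    count U0 (l (false, true)) = count U0 (l (true, true)) ->
    (forall s t, s \in l (false, false) -> t \in l (true, true) -> (s <= t)%O ->
      D s -> U0 t || U1 t) ->
    has D (l (false, false)) ->
    diamond a b c d ->
  ~ support_realizes (fun t => l ((b <= t)%O, (c <= t)%O)) X.
Proof.
move=> D_down U0_up U1_up DU0 DU1 D1 D2 cU1 cU0 D_U D_has.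
case=> /andP[ab bd] /andP[ac cd] /negbTE bc /negbTE cb [Xmono Xin Xtight Xhas].
have ba : (b <= a)%O = false by apply: contraFF bc => /le_trans; apply.
have ca : (c <= a)%O = false by apply: contraFF cb => /le_trans; apply.
move: (Xin a) (Xin d) (Xtight b a) (Xtight c a) (Xtight b d) (Xtight c d) (Xhas a D).
rewrite ba ca bd cd bc cb !lexx => Xa Xd ba_tight ca_tight bd_tight cd_tight.
case=> // t Dt.
have Db : D (X b t).
  by apply: (ba_tight D D) => // s h; exact: D_down h (Xmono _ _ _ ab).
have Dc : D (X c t).
  by apply: (ca_tight D D) => // s h; exact: D_down h (Xmono _ _ _ ac).
case/orP: (D_U _ _ (Xa t) (Xd t) (Xmono _ _ t (le_trans ab bd)) Dt) => Ud.
  have := DU0 _ Dc; rewrite (cd_tight U0 U0) // => s h.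
  exact: U0_up h (Xmono _ _ _ cd).
have := DU1 _ Db; rewrite (bd_tight U1 U1) // => s h.
exact: U1_up h (Xmono _ _ _ bd).
Qed.

(** Where [D] holds at [a] it still holds at [c]. But [V] at [b] descends to [a], and [W] at [d]
    descends to [c], and one of the two must occur. *)
Lemma diamond_diamond_obstruction (l : bool * bool -> seq S)
    (D V W : pred S) (a b c d : A) (T : Type) (X : A -> T -> S) :
    (forall x y, D y -> (x <= y)%O -> D x) ->
    (forall x y, V x -> (x <= y)%O -> V y) ->
    (forall x y, W x -> (x <= y)%O -> W y) ->
    (forall x, D x -> ~~ V x) -> (forall x, D x -> ~~ W x) ->
    count D (l (false, false)) = count D (l (false, true)) ->
    count V (l (false, false)) = count V (l (true, false)) ->
    count W (l (false, true)) = count W (l (true, true)) ->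
    (forall s t, s \in l (true, false) -> t \in l (true, true) -> (s <= t)%O ->
      V s || W t) ->
    has D (l (false, false)) ->
    diamond a b c d ->
  ~ support_realizes (fun t => l ((b <= t)%O, (c <= t)%O)) X.
Proof.
move=> D_down V_up W_up DV DW cD cV cW VW D_has.
case=> /andP[ab bd] /andP[ac cd] /negbTE bc /negbTE cb [Xmono Xin Xtight Xhas].
have ba : (b <= a)%O = false by apply: contraFF bc => /le_trans; apply.
have ca : (c <= a)%O = false by apply: contraFF cb => /le_trans; apply.
move: (Xin b) (Xin d) (Xtight c a) (Xtight a b) (Xtight c d) (Xhas a D).
rewrite ba ca bd cd bc cb !lexx => Xb Xd ca_tight ab_tight cd_tight.
case=> // t Dt.
have Dc : D (X c t).
  by apply: (ca_tight D D) => // s h; exact: D_down h (Xmono _ _ _ ac).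
case/orP: (VW _ _ (Xb t) (Xd t) (Xmono _ _ t bd)) => [Vb|Wd].
  have := DV _ Dt; rewrite (ab_tight V V) // => s h.
  exact: V_up h (Xmono _ _ _ ab).
have := DW _ Dc; rewrite (cd_tight W W) // => s h.
exact: W_up h (Xmono _ _ _ cd).
Qed.

End obstructions.

(** * The four counterexamples *)

Section counterexamples.
Variables (R : realType) (dA dS : Order.disp_t).
Variables (A : finPOrderType dA) (S : finPOrderType dS).
Hypothesis equivalence : monotonicity_equivalence R A S.

Lemma count_none (E : pred S) k : (forall s, s \in k -> ~~ E s) -> count E k = 0%N.
Proof. by move=> h; apply/eqP; rewrite eqn0Ngt -has_count; apply/hasPn. Qed.

Lemma count_cons (E : pred S) x k : count E (x :: k) = (E x + count E k)%N.
Proof. by []. Qed.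

Lemma all2_rcons (k l : seq S) x y : size k = size l ->
  all2 <=%O (rcons k x) (rcons l y) = (x <= y)%O && all2 <=%O k l.
Proof.
elim: k l => [|s k IHk] [|t l] //= [kl].
by rewrite IHk // andbCA.
Qed.

(** The index map is monotone into the four-point Boolean lattice, whose five strict relations are
    the hypotheses. *)
Lemma diamond_index_matched (l : bool * bool -> seq S) :
    matched (l (false, false)) (l (true, false)) ->
    matched (l (false, false)) (l (false, true)) ->
    matched (l (false, false)) (l (true, true)) ->
    matched (l (true, false)) (l (true, true)) ->
    matched (l (false, true)) (l (true, true)) ->
  forall (b c s t : A), (s <= t)%O ->
    matched (l ((b <= s)%O, (c <= s)%O)) (l ((b <= t)%O, (c <= t)%O)).
Proof.
move=> h1 h2 h3 h4 h5 b c s t st.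
have := @le_trans _ _ s b t; have := @le_trans _ _ s c t; rewrite st.
case: (b <= s)%O; case: (c <= s)%O; case: (b <= t)%O; case: (c <= t)%O => //;
  do ?[by move/(_ isT isT)|by move=> _ /(_ isT isT)]; move=> _ _; exact: matched_refl.
Qed.

Lemma bowtie_index_matched (l : bool * bool -> seq S) :
    (forall i j, matched (l (false, i)) (l (true, j))) ->
  forall p q, bowtie_le p q -> matched (l p) (l q).
Proof.
move=> h p q /orP[/eqP -> |]; first exact: matched_refl.
by case: p q => [[] i] [[] j].
Qed.

Section diamond_in_S.
Variables (x y z w : S).
Hypothesis xyzw : diamond x y z w.

Let xy : (x <= y)%O. Proof. by case: xyzw => /andP[]. Qed.
Let xz : (x <= z)%O. Proof. by case: xyzw => _ /andP[]. Qed.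
Let yw : (y <= w)%O. Proof. by case: xyzw => /andP[]. Qed.
Let zw : (z <= w)%O. Proof. by case: xyzw => _ /andP[]. Qed.
Let yz : (y <= z)%O = false. Proof. by case: xyzw => _ _ /negbTE. Qed.
Let zy : (z <= y)%O = false. Proof. by case: xyzw => _ _ _ /negbTE. Qed.
Let yx : (y <= x)%O = false. Proof. by apply: contraFF yz => /le_trans; apply. Qed.
Let zx : (z <= x)%O = false. Proof. by apply: contraFF zy => /le_trans; apply. Qed.
Let wy : (w <= y)%O = false. Proof. by apply: contraFF zy; exact: le_trans. Qed.
Let wz : (w <= z)%O = false. Proof. by apply: contraFF yz; exact: le_trans. Qed.
Let wx : (w <= x)%O = false. Proof. by apply: contraFF yx; exact: le_trans. Qed.

Let le_eqs := (xy, xz, yw, zw, yz, zy, yx, zx, wy, wz, wx, @lexx dS S,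
  le_trans xy yw).

Lemma diamond_diamond_false (a b c d : A) : ~ diamond a b c d.
Proof.
move=> abcd.
(* Where the value at [a] is [x], it is [z] at [b] because the events of value [y] coincide there;
   it stays [x] at [c], hence is [y] at [d]. But [z] is not below [y]. *)
pose l (i : bool * bool) : seq S := match i with
  | (false, false) => [:: x; y] | (true, false) => [:: y; z]
  | (false, true) => [:: x; w] | (true, true) => [:: y; w] end.
have [||T [X]] :=
  uniform_system (L := fun t => l ((b <= t)%O, (c <= t)%O)) (n := 1) x _ _
    equivalence.
- by move=> t; case: (b <= t)%O (c <= t)%O => -[].
- apply: diamond_index_matched => /=.
  + by exists [:: z; y]; rewrite /= ?le_eqs // (perm_catC [:: z]).
  + by exists [:: x; w]; rewrite /= ?le_eqs.
  + by exists [:: y; w]; rewrite /= ?le_eqs.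
  + by exists [:: y; w]; rewrite /= ?le_eqs.
  + by exists [:: y; w]; rewrite /= ?le_eqs.
apply: (diamond_diamond_obstruction (l := l) (D := fun s => (s <= x)%O)
  (V := fun s => (y <= s)%O) (W := fun s => (w <= s)%O)) abcd; rewrite /= ?le_eqs //.

- by move=> s t tx st; exact: le_trans st tx.
- by move=> s t; exact: le_trans.
- by move=> s t; exact: le_trans.
- by move=> s sx; apply/negP => /le_trans/(_ sx); rewrite yx.
- by move=> s sx; apply/negP => /le_trans/(_ sx); rewrite wx.
- move=> s t; rewrite !inE => /orP[]/eqP -> /orP[]/eqP ->; by rewrite !le_eqs.
Qed.

Lemma diamond_bowtie_false (u v : A) : diamond_free A -> covers v u ->
  ~ connect (avoiding u v) u v.
Proof.
move=> nd uv conn.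
(* Away from the edge of [u] and [v], value [y] over [(false, false)] forces [y] over
   [(true, true)], then [x] over [(false, true)] and over [(true, false)]. *)
pose l (i : bool * bool) : seq S := match i with
  | (false, false) => [:: x; y] | (false, true) => [:: x; z]
  | (true, false) => [:: x; w] | (true, true) => [:: y; z] end.
have [||T [X]] :=
  uniform_system (L := fun t => l (fold_to_bowtie u v t)) (n := 1) x _ _
    equivalence.
- by move=> t; case: (fold_to_bowtie u v t) => -[] [].
- move=> s t /(fold_to_bowtie_mono nd uv); apply: bowtie_index_matched => -[] [] /=.
  + by exists [:: y; z]; rewrite /= ?le_eqs.
  + by exists [:: x; w]; rewrite /= ?le_eqs.
  + by exists [:: z; y]; rewrite /= ?le_eqs // (perm_catC [:: z]).
  + by exists [:: x; w]; rewrite /= ?le_eqs.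
apply: (bowtie_obstruction (l := l) (D := fun s => (s <= x)%O)
  (U0 := fun s => (y <= s)%O) (U1 := fun s => (z <= s)%O)) uv conn
    (fold_to_bowtie_mono nd uv) (fold_to_bowtie_edge uv)
    (fold_to_bowtie_u uv) (fold_to_bowtie_v u v);
  rewrite /= ?le_eqs //.
- by move=> s t tx st; exact: le_trans st tx.
- by move=> s t; exact: le_trans.
- by move=> s t; exact: le_trans.
- by move=> s sx; apply/negP => /le_trans/(_ sx); rewrite yx.
- by move=> s sx; apply/negP => /le_trans/(_ sx); rewrite zx.
- move=> s t; rewrite !inE => /orP[]/eqP -> /orP[]/eqP ->; by rewrite !le_eqs.
Qed.

End diamond_in_S.

Section crown_in_S.
Variables (x0 x1 : S) (xs : seq S) (y0 yn : S) (ys : seq S).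
Hypothesis crownS : crown x0 x1 xs y0 yn ys.

Let D : pred S := fun s => (s <= x0)%O.
Let U0 : pred S := fun s => (yn <= s)%O.
Let U1 : pred S := fun s => (y0 <= s)%O.

Let D_down s t : D t -> (s <= t)%O -> D s.
Proof. by move=> tx st; exact: le_trans st tx. Qed.

Let U0_up s t : U0 s -> (s <= t)%O -> U0 t. Proof. exact: le_trans. Qed.
Let U1_up s t : U1 s -> (s <= t)%O -> U1 t. Proof. exact: le_trans. Qed.

Lemma all2_mem_r (k l : seq S) t : all2 <=%O k l -> t \in l ->
  exists2 s, s \in k & (s <= t)%O.
Proof.
elim: k l => [|s k IHk] [|t' l] //= /andP[st kl]; rewrite inE => /orP[/eqP ->|].
  by exists s; rewrite ?mem_head.
by case/(IHk _ kl) => s' s'k s't; exists s'; rewrite // inE s'k orbT.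
Qed.

Let y0D : ~~ D y0.
Proof.
apply/negP => y0x0; have := crown_xs_x0 crownS (mem_head _ _).
by rewrite (le_trans (crown_x1y0 crownS) y0x0).
Qed.

Let ysD y : y \in rcons ys yn -> ~~ D y.
Proof.
case/(all2_mem_r (crown_straight crownS)) => x xxs xy; apply/negP => yx0.
by have := crown_xs_x0 crownS xxs; rewrite (le_trans xy yx0).
Qed.

Let xsD x : x \in x1 :: xs -> ~~ D x. Proof. exact: crown_xs_x0 crownS x. Qed.

Let ynD : ~~ D yn. Proof. by apply: ysD; rewrite mem_rcons mem_head. Qed.

Let DU0 s : D s -> ~~ U0 s.
Proof. by move=> sx; apply: contra ynD => h; exact: le_trans h sx. Qed.

Let DU1 s : D s -> ~~ U1 s.
Proof. by move=> sx; apply: contra y0D => h; exact: le_trans h sx. Qed.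

Let xsU0 x : x \in x1 :: xs -> ~~ U0 x.
Proof.
by move/(crown_x0_xs crownS); apply: contra => /(le_trans (crown_x0yn crownS)).
Qed.

Let xsU1 x : x \in x1 :: xs -> ~~ U1 x.
Proof.
by move/(crown_x0_xs crownS); apply: contra => /(le_trans (crown_x0y0 crownS)).
Qed.

Let countD_xs : count D (x1 :: xs) = 0%N := count_none xsD.
Let countD_ys : count D (rcons ys yn) = 0%N := count_none ysD.
Let countU0_xs : count U0 (x1 :: xs) = 0%N := count_none xsU0.
Let countU1_xs : count U1 (x1 :: xs) = 0%N := count_none xsU1.
Let countU0_ys : count U0 (y0 :: ys) = 0%N := count_none (crown_yn_ys crownS).
Let countU1_ys : count U1 (rcons ys yn) = 0%N := count_none (crown_y0_ys crownS).

Let Dx0 : D x0. Proof. exact: lexx. Qed.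

Let X := [:: x0, x1 & xs].
Let Y := y0 :: rcons ys yn.

Let countD_X : count D X = 1%N.
Proof. by rewrite /X count_cons countD_xs Dx0. Qed.

Let countU0_X : count U0 X = 0%N.
Proof. by rewrite /X count_cons countU0_xs (negbTE (DU0 Dx0)). Qed.

Let countU1_X : count U1 X = 0%N.
Proof. by rewrite /X count_cons countU1_xs (negbTE (DU1 Dx0)). Qed.

Let countD_Y : count D Y = 0%N.
Proof. by rewrite /Y count_cons countD_ys (negbTE y0D). Qed.

Let countU0_Y : count U0 Y = 1%N.
Proof. by rewrite /Y -rcons_cons -cats1 count_cat countU0_ys /= /U0 lexx. Qed.

Let countU1_Y : count U1 Y = 1%N.
Proof. by rewrite /Y /= countU1_ys /U1 lexx. Qed.

(** The key restriction on realizations: within [Y], the value [x0] can only move up to [y0] or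
    [yn]. *)
Let above_x0 t : t \in y0 :: rcons ys yn -> (x0 <= t)%O -> U0 t || U1 t.
Proof.
rewrite inE mem_rcons inE => /or3P[/eqP ->|/eqP ->|tys] x0t.
- by rewrite /U1 lexx orbT.
- by rewrite /U0 lexx.
- by have := crown_x0_ys crownS tys; rewrite x0t.
Qed.

Let size_xs : size xs = size ys.
Proof. by have := crown_shift crownS; rewrite all2E => /andP[/eqP]. Qed.


Lemma crown_bowtie_false (u v : A) : diamond_free A -> covers v u ->
  ~ connect (avoiding u v) u v.
Proof.
move=> nd uv conn.
(* Over [(false, true)] and [(true, true)] the values [y0] correspond, so [x0] must become [yn].
   Around the cycle, [yn] at [u] thus turns into [x0] at [v]. *)
pose l (i : bool * bool) : seq S := match i with
  | (false, false) => yn :: X | (false, true) => y0 :: X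
  | (true, false) => x0 :: Y | (true, true) => x1 :: Y end.
have [||T [Z]] := uniform_system (L := fun t => l (fold_to_bowtie u v t))
    (n := (size xs).+2) x0 _ _ equivalence.
- by move=> t; case: (fold_to_bowtie u v t) => -[] []; rewrite /= ?size_rcons size_xs.
- have [x0y0 x0yn x1y0 shift straight _ _ _ _ _] := crownS.
  move: straight => /= straight.
  move=> s t /(fold_to_bowtie_mono nd uv); apply: bowtie_index_matched => -[] [] /=.
  (* In each matching the points common to both lists stay fixed, and the others climb the zigzag,
     straight or shifted by one. *)
  + exists [:: y0, yn, x1 & ys]; last by rewrite /= lexx x0yn lexx.
    rewrite (perm_catCA [:: y0; yn] [:: x1]) /= perm_cons perm_cons.
    by rewrite perm_sym perm_rcons.
  + exists [:: y0, x0 & rcons ys yn]; last by rewrite /= !lexx.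
    by rewrite (perm_catCA [:: y0] [:: x0]).
  + exists [:: yn, y0, x1 & ys]; last by rewrite /= !lexx x0y0.
    rewrite (perm_catCA [:: yn; y0] [:: x1]) /= perm_cons /Y -rcons_cons.
    by rewrite perm_sym perm_rcons.
  + exists [:: yn, x0, y0 & ys]; last by rewrite /= !lexx x1y0.
    rewrite (perm_catCA [:: yn] [:: x0]) /= perm_cons /Y -rcons_cons.
    by rewrite perm_sym perm_rcons.
apply: (bowtie_obstruction (l := l) D_down U0_up U1_up DU0 DU1 _ _ _ _ _ _ uv conn
    (fold_to_bowtie_mono nd uv) (fold_to_bowtie_edge uv)
    (fold_to_bowtie_u uv) (fold_to_bowtie_v u v)); rewrite /l.
- by rewrite (count_cons D y0 X) (count_cons D x0 Y) countD_X countD_Y Dx0 (negbTE y0D).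
- by rewrite (count_cons U0 yn X) (count_cons U0 x1 Y) countU0_X countU0_Y
    (negbTE (xsU0 (mem_head _ _))) /U0 lexx.
- by rewrite (count_cons U1 y0 X) (count_cons U1 x1 Y) countU1_X countU1_Y
    (negbTE (xsU1 (mem_head _ _))) /U1 lexx.
- by rewrite (count_cons D y0 X) (count_cons U0 x1 Y) countD_X countU0_Y
    (negbTE y0D) (negbTE (xsU0 (mem_head _ _))).
- move=> s t; rewrite inE => /orP[/eqP -> _ _ /idPn|]; first by rewrite y0D.
  rewrite inE => /orP[/eqP -> |/xsD/negbTE -> //].
  rewrite inE => /orP[/eqP -> x0x1 _|tY x0t _]; last exact: above_x0.
  by have := crown_x0_xs crownS (mem_head _ _); rewrite x0x1.
- by rewrite /= /U0 lexx.
Qed.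

Lemma crown_diamond_false (a b c d : A) : ~ diamond a b c d.
Proof.
move=> abcd.
have [x0y0 x0yn x1y0 shift straight _ _ _ _ _] := crownS.
(* [xn] is the last lower point of the zigzag, equal to [x1] when [xs] is empty. *)
have [xs' [xn xsE]] : exists xs' xn, x1 :: xs = rcons xs' xn.
  by exists (belast x1 xs), (last x1 xs); exact: lastI.
have size_xs' : size xs' = size ys.
  by move/(congr1 size): xsE; rewrite /= size_rcons size_xs => -[].
have /andP[xnyn xs'ys] : (xn <= yn)%O && all2 <=%O xs' ys.
  by move: straight; rewrite xsE all2_rcons.
(* From [a], the law at [b] raises only [x1] to [y0], and the law at [c] only [xn] to [yn]. At [d]
   the value [x0] has to become [y0] or [yn], but these are already taken by the points carrying
   them at [b] and [c]. *)
pose l (i : bool * bool) : seq S := match i with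
  | (false, false) => X | (true, false) => [:: x0, y0 & xs]
  | (false, true) => x0 :: rcons xs' yn | (true, true) => Y end.
have [||T [Z]] := uniform_system (L := fun t => l ((b <= t)%O, (c <= t)%O))
    (n := (size xs).+1) x0 _ _ equivalence.
- move=> t; case: (b <= t)%O (c <= t)%O => -[];
    by rewrite /= ?size_rcons ?size_xs' size_xs.
- apply: diamond_index_matched => /=.
  + by exists [:: x0, y0 & xs]; rewrite //= lexx x1y0 all2_refl.
  + exists (x0 :: rcons xs' yn) => //; rewrite /X xsE /= lexx all2_rcons // xnyn.
    exact: all2_refl.
  + by exists Y => //; rewrite /= x0y0.
  + exists [:: yn, y0 & ys]; last by rewrite /= x0yn lexx.
    by rewrite /Y -rcons_cons perm_sym perm_rcons.
  + by exists Y; rewrite //= x0y0 all2_rcons // lexx.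
have xs'D s : s \in xs' -> ~~ D s.
  by move=> sxs; apply: xsD; rewrite xsE mem_rcons inE sxs orbT.
have xs'U0 s : s \in xs' -> ~~ U0 s.
  by move=> sxs; apply: xsU0; rewrite xsE mem_rcons inE sxs orbT.
have xsD' s : s \in xs -> ~~ D s by move=> sxs; apply: xsD; rewrite inE sxs orbT.
have xsU1' s : s \in xs -> ~~ U1 s by move=> sxs; apply: xsU1; rewrite inE sxs orbT.
apply: (crown_diamond_obstruction (l := l) D_down U0_up U1_up DU0 DU1
  _ _ _ _ _ _ abcd); rewrite /l.
- by rewrite countD_X 2!count_cons Dx0 (negbTE y0D) (count_none xsD').
- by rewrite countD_X count_cons Dx0 -cats1 count_cat (count_none xs'D) /= (negbTE ynD).
- rewrite countU1_Y 2!count_cons (negbTE (DU1 Dx0)) /U1 lexx.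
  by rewrite (count_none xsU1').
- rewrite countU0_Y count_cons -cats1 count_cat (count_none xs'U0) /= (negbTE (DU0 Dx0)).
  by rewrite /U0 lexx.
- move=> s t; rewrite inE => /orP[/eqP -> tY x0t _|/xsD/negbTE -> //].
  exact: above_x0.
- by rewrite /= Dx0.
Qed.

End crown_in_S.
End counterexamples.

(** * The two directions of the equivalence *)

Lemma acyclic_equivalence (R : realType) (dA dS : Order.disp_t)
    (A : finPOrderType dA) (S : finPOrderType dS) :
  connected_poset A -> acyclic_poset A -> monotonicity_equivalence R A S.
Proof.
move=> A_conn A_acyc x0 P P_mono; apply: finitely_realizable_realizable.
have sum_mass a (U : {set S}) :
    (\sum_(s in U) mass (P a) s)%:E = P a [set` U]%classic.
  by rewrite probability_mass; congr EFin; apply: eq_bigl => s; rewrite mem_setE.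
have mass_mono a b : (a <= b)%O -> dominated (mass (P a)) (mass (P b)).
  by move=> ab U Uup; rewrite -lee_fin !sum_mass; exact: P_mono.
have [T [w [X [w_ge0 w_sum1 Xmono Xp]]]] :=
  realized_on_all x0 (fun a => mass_ge0 (P a)) (fun a => mass_sum1 (P a))
    mass_mono A_acyc A_conn.
exists T, w, X; split=> // [a b t ab wt|a s]; last by rewrite Xp ?inE.
apply: (le_ind_covers (Q := fun a b => (X a t <= X b t)%O)) ab => [c|c e f|c e].
- exact: lexx.
- exact: le_trans.
- by move=> ec; apply: Xmono; rewrite ?inE.
Qed.

Lemma diamond_free_or (d : Order.disp_t) (S : finPOrderType d) :
  diamond_free S \/ exists x y z w : S, diamond x y z w.
Proof.
have [|no] := pselect (exists x y z w : S, diamond x y z w); first by right.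
by left=> x y z w xyzw; apply: no; exists x, y, z, w.
Qed.

Theorem theorem4p2 (R : realType) (dA dS : Order.disp_t)
    (A : finPOrderType dA) (S : finPOrderType dS)
    (S_class_B : class_B S) (A_connected : connected_poset A) :
  monotonicity_equivalence R A S <-> acyclic_poset A.
Proof.
split=> [equiv A_cycle|]; last exact: acyclic_equivalence.
case: S_class_B => _ S_shape.
have [Snd|[x [y [z [w xyzw]]]]] := diamond_free_or S; last first.
  have [And|[a [b [c [d abcd]]]]] := diamond_free_or A.
    have [u [v [uv conn]]] := cycle_edge A_cycle.
    exact: (diamond_bowtie_false equiv xyzw And uv conn).
  exact: (diamond_diamond_false equiv xyzw abcd).
have [x0 [x1 [xs [y0 [yn [ys crownS]]]]]] : has_crown S.
  by case: S_shape => [/(cycle_crown Snd)|/bowtie_crown].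
have [And|[a [b [c [d abcd]]]]] := diamond_free_or A.
  have [u [v [uv conn]]] := cycle_edge A_cycle.
  exact: (crown_bowtie_false equiv crownS And uv conn).
exact: (crown_diamond_false equiv crownS abcd).
Qed.
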